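(* Let $P=\mathcal N(0,I_d)$ and $Q=\mathcal N(\mu,I_d)$ on $\mathbb R^d$, let $\kappa$ be the RBF kernel with bandwidth $\gamma$, and let $\rho_d$ be the moment ratio of the function $u_P^{\mathrm{KSD}}$ under $Q$. Assume $\gamma=\omega(1)$ and $\|\mu\|_2^2=\Omega(1)$. Then: (i) if $\gamma=o(d^{1/2})$, then $\rho_d=\exp\big(\frac{3d}{4\gamma^2}+o(\frac d{\gamma^2})\big)\,\Theta\Big(\frac{d}{\gamma\|\mu\|_2^2}+\frac{d^{1/2}}{\gamma^{1/2}\|\mu\|_2}+1\Big)$; (ii) if $\gamma=\omega(d^{1/2})$, then $\rho_d=\Theta\Big(\frac{d^{1/2}(1+\gamma^{-1/2}\|\mu\|_2)}{\|\mu\|_2(1+\gamma^{-1}d^{1/2}\|\mu\|_2)}+1\Big)$; (iii) if $\gamma=\Theta(d^{1/2})$, then $\rho_d=\Theta\Big(\frac{d^{1/2}}{\|\mu\|_2^2}+\frac{d^{1/4}}{\|\mu\|_2}+1\Big)$.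
   Context: Here $d=d_n\in\mathbb N$, $\gamma=\gamma_n>0$ and $\mu=\mu_n\in\mathbb R^{d_n}$ vary with $n$, and $o,O,\Theta,\omega,\Omega$ are the usual asymptotic notations as $n\to\infty$. RBF kernel: $\kappa(\mathbf x,\mathbf x')=\exp(-\|\mathbf x-\mathbf x'\|_2^2/(2\gamma))$. With $p$ the density of $P$ (so $\nabla\log p(\mathbf x)=-\mathbf x$), $$u_P^{\mathrm{KSD}}(\mathbf x,\mathbf x')=(\nabla\log p(\mathbf x))^\top(\nabla\log p(\mathbf x'))\kappa(\mathbf x,\mathbf x')+(\nabla\log p(\mathbf x))^\top\nabla_2\kappa(\mathbf x,\mathbf x')+(\nabla\log p(\mathbf x'))^\top\nabla_1\kappa(\mathbf x,\mathbf x')+\mathrm{Tr}(\nabla_1\nabla_2\kappa(\mathbf x,\mathbf x'))$$ $$=\exp\Big(-\frac{\|\mathbf x-\mathbf x'\|_2^2}{2\gamma}\Big)\Big(\mathbf x^\top\mathbf x'-\frac{\gamma+1}{\gamma^2}\|\mathbf x-\mathbf x'\|_2^2+\frac d\gamma\Big).$$ For $\mathbf X_1,\mathbf X_2$ i.i.d. $\sim Q$: $\rho_d=\sigma_{\mathrm{full}}/\sigma_{\mathrm{cond}}$ with $\sigma_{\mathrm{full}}=\sqrt{\mathrm{Var}[u_P^{\mathrm{KSD}}(\mathbf X_1,\mathbf X_2)]}$ and $\sigma_{\mathrm{cond}}=\sqrt{\mathrm{Var}\,\mathbb E[u_P^{\mathrm{KSD}}(\mathbf X_1,\mathbf X_2)|\mathbf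 X_1]}$. *)

(* Defs.v *)
From HB Require Import structures.
From mathcomp Require Import all_boot all_order all_algebra.
From mathcomp Require Import all_classical all_reals all_analysis.
Import Order.TTheory GRing.Theory Num.Theory.
Import numFieldNormedType.Exports.

Set Implicit Arguments.
Unset Strict Implicit.
Unset Printing Implicit Defensive.

Local Open Scope classical_set_scope.
Local Open Scope ring_scope.

Definition dot (R : realType) (d : nat) (x y : 'rV[R]_d) : R :=
  \sum_(i < d) x ord0 i * y ord0 i.

(** The library norm [`|x|] on ['rV[R]_d] is the sup norm, not this one. *)
Definition norm2 (R : realType) (d : nat) (x : 'rV[R]_d) : R :=
  Num.sqrt (dot x x).

Definition grad (R : realType) (d : nat) (f : 'rV[R]_d -> R)
    (x : 'rV[R]_d) : 'rV[R]_d :=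
  \row_i 'D_(delta_mx ord0 i) f x.

Definition grad1 (R : realType) (d : nat) (k : 'rV[R]_d -> 'rV[R]_d -> R)
    (x x' : 'rV[R]_d) : 'rV[R]_d :=
  grad (fun z => k z x') x.

Definition grad2 (R : realType) (d : nat) (k : 'rV[R]_d -> 'rV[R]_d -> R)
    (x x' : 'rV[R]_d) : 'rV[R]_d :=
  grad (fun z => k x z) x'.

(** The matrix of mixed derivatives of [k] with respect to the [i]-th
    coordinate of [x] and the [j]-th coordinate of [x']. *)
Definition grad12 (R : realType) (d : nat) (k : 'rV[R]_d -> 'rV[R]_d -> R)
    (x x' : 'rV[R]_d) : 'M[R]_d :=
  \matrix_(i, j) 'D_(delta_mx ord0 i) (fun z => grad2 k z x' ord0 j) x.

Definition rbf (R : realType) (d : nat) (gamma : R) (x x' : 'rV[R]_d) : R :=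
  expR (- (norm2 (x - x') ^+ 2 / (2 * gamma))).

Definition score (R : realType) (d : nat) (p : 'rV[R]_d -> R)
    (x : 'rV[R]_d) : 'rV[R]_d :=
  grad (fun z => ln (p z)) x.

Definition u_ksd (R : realType) (d : nat) (p : 'rV[R]_d -> R)
    (k : 'rV[R]_d -> 'rV[R]_d -> R) (x x' : 'rV[R]_d) : R :=
  dot (score p x) (score p x') * k x x'
  + dot (score p x) (grad2 k x x')
  + dot (score p x') (grad1 k x x')
  + \tr (grad12 k x x').

(** The sigma-algebra on R^d is the product one, generated by the
    coordinates. *)
Section rV_measurable.
Context {R : realType} {d : nat}.

Let coors : 'I_d -> 'rV[R]_d -> R := fun i x => x ord0 i.

Let rV_set0 : g_sigma_preimage coors set0.
Proof. exact: sigma_algebra0. Qed.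

Let rV_setC A : g_sigma_preimage coors A -> g_sigma_preimage coors (~` A).
Proof. exact: sigma_algebraC. Qed.

Let rV_bigcup (F : (set 'rV[R]_d)^nat) :
  (forall i, g_sigma_preimage coors (F i)) ->
  g_sigma_preimage coors (\bigcup_i (F i)).
Proof. exact: sigma_algebra_bigcup. Qed.

HB.instance Definition _ := @isMeasurable.Build default_measure_display
  'rV[R]_d (g_sigma_preimage coors) rV_set0 rV_setC rV_bigcup.

Lemma measurable_rV_coord (i : 'I_d) :
  measurable_fun [set: 'rV[R]_d] (fun x : 'rV[R]_d => x ord0 i).
Proof.
move=> _ Y mY; rewrite setTI; apply: sub_sigma_algebra => /=.
rewrite -bigcup_seq/=; exists i => /=; first by rewrite mem_index_enum.
by exists Y => //; rewrite setTI.
Qed.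

Lemma measurable_fun_rV (d' : measure_display) (T : measurableType d')
    (f : T -> 'rV[R]_d) :
  (forall i, measurable_fun [set: T] (fun t => f t ord0 i)) ->
  measurable_fun [set: T] f.
Proof.
move=> mf _ A; rewrite setTI.
move: A; apply: smallest_sub.
  split=> [|A mA|F mF]; first by rewrite /= preimage_set0; exact: measurable0.
    by rewrite /= setTD preimage_setC; exact: measurableC.
  by rewrite /= preimage_bigcup; exact: bigcup_measurable.
elim/big_ind : _ => [A //|A B sA sB C [/sA|/sB] //|i _ _ [B mB <-]] /=.
by have := mf i measurableT B mB; rewrite !setTI.
Qed.

End rV_measurable.

Section rV_cons.
Context (R : realType) (d : nat).

Definition rV_cons (w : measurableTypeR R * 'rV[R]_d) : 'rV[R]_d.+1 :=
  \row_i oapp (fun j => w.2 ord0 j) w.1 (unlift ord0 i).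

Let measurable_rV_cons : measurable_fun setT rV_cons.
Proof.
apply: measurable_fun_rV => i; under eq_fun do rewrite mxE.
case: (unlift ord0 i) => [j|] /=; last exact: measurable_fst.
exact: measurableT_comp (measurable_rV_coord j) measurable_snd.
Qed.

HB.instance Definition _ := isMeasurableFun.Build _ _ _ _ rV_cons
  measurable_rV_cons.

End rV_cons.

(** N(mu, I_d) is the product of the laws N(mu_i, 1); see [gaussian_box]. *)
Fixpoint gaussian (R : realType) (d : nat) :
    'rV[R]_d -> probability 'rV[R]_d R :=
  match d with
  | 0%N => fun _ => dirac (0 : 'rV[R]_0)
  | d'.+1 => fun mu => distribution
      (normal_prob (mu ord0 ord0) 1 \x gaussian (col' ord0 mu))%E
      (@rV_cons R d')
  end.

Lemma gaussian_box (R : realType) (d : nat) (mu : 'rV[R]_d)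
    (A : 'I_d -> set R) :
  (forall i, measurable (A i)) ->
  gaussian mu [set x | forall i, A i (x ord0 i)] =
  (\prod_(i < d) normal_prob (mu ord0 i) 1 (A i))%E.
Proof.
elim: d => [|d IH] in mu A *; move=> mA.
  by rewrite big_ord0 /= diracE mem_set// => -[].
rewrite big_ord_recl /= /distribution /pushforward /=.
have -> : @rV_cons R d @^-1` [set x | forall i, A i (x ord0 i)] =
    A ord0 `*`
      [set x : 'rV[R]_d | forall i : 'I_d, A (lift ord0 i) (x ord0 i)].
  apply/seteqP; split => -[x y] /=.
    move=> Axy; split => [|i]; first by have := Axy ord0; rewrite mxE unlift_none.
    by have := Axy (lift ord0 i); rewrite mxE liftK.
  move=> [Ax Ay] i; rewrite mxE.
  by case: (unliftP ord0 i) => [j ->|->] /=.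
rewrite product_measure1E; [|exact: (mA ord0)|]; last first.
  rewrite (_ : mkset _ = \bigcap_(i in [set: 'I_d])
      (fun x : 'rV[R]_d => x ord0 i) @^-1` A (lift ord0 i)); last first.
    by apply/seteqP; split => x /= H i; [move=> _|]; exact: H.
  apply: fin_bigcap_measurable => // i _; rewrite -[X in measurable X]setTI.
  exact: measurable_rV_coord.
congr (_ * _)%E.
rewrite (eq_bigr (fun i => normal_prob (col' ord0 mu ord0 i) 1
    (A (lift ord0 i)))); last by move=> i _; rewrite mxE.
exact: IH.
Qed.

(** The Lebesgue density of N(mu, I_d). *)
Definition gaussian_pdf (R : realType) (d : nat) (mu x : 'rV[R]_d) : R :=
  \prod_(i < d) normal_pdf (mu ord0 i) 1 (x ord0 i).

(** [Z] is a version of the conditional expectation of [Y] given [X]. *)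
Definition is_cond_exp (d d' : measure_display) (T : measurableType d)
    (T' : measurableType d') (R : realType) (P : probability T R)
    (X : T -> T') (Y Z : T -> R) : Prop :=
  [/\ measurable_fun [set: g_sigma_algebra_preimageType X] Z,
      P.-integrable [set: T] (EFin \o Z) &
      forall A : set T', measurable A ->
        (\int[P]_(w in X @^-1` A) (Z w)%:E =
         \int[P]_(w in X @^-1` A) (Y w)%:E)%E].

(** An arbitrary version, which exists as soon as [Y] is integrable. *)
Definition cond_exp (d d' : measure_display) (T : measurableType d)
    (T' : measurableType d') (R : realType) (P : probability T R)
    (X : T -> T') (Y : T -> R) : T -> R :=
  get (is_cond_exp P X Y).

(** [sigma_full / sigma_cond] for the i.i.d. pair (X_1, X_2) with law [Q] given
    by the coordinates of the product space. *)
Definition sigma_full (d : measure_display) (T : measurableType d)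
    (R : realType) (Q : probability T R) (u : T -> T -> R) : R :=
  Num.sqrt (fine 'V_(Q \x Q)%E[fun w => u w.1 w.2]).

Definition sigma_cond (d : measure_display) (T : measurableType d)
    (R : realType) (Q : probability T R) (u : T -> T -> R) : R :=
  Num.sqrt (fine
    'V_(Q \x Q)%E[cond_exp (Q \x Q)%E fst (fun w => u w.1 w.2)]).

Definition moment_ratio (d : measure_display) (T : measurableType d)
    (R : realType) (Q : probability T R) (u : T -> T -> R) : R :=
  sigma_full Q u / sigma_cond Q u.

(* Main.v *)
Require Import Defs.
From mathcomp Require Import all_boot all_order all_algebra.
From mathcomp Require Import all_classical all_reals all_analysis.
From mathcomp Require Import measurable_realfun.
From mathcomp Require Import ring lra.
Import Order.TTheory GRing.Theory Num.Theory.
Import numFieldNormedType.Exports.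
Local Open Scope classical_set_scope.
Local Open Scope ring_scope.

Set Implicit Arguments.
Unset Strict Implicit.
Unset Printing Implicit Defensive.

(** Write M for the squared norm of mu, D for the dimension, g for the
    bandwidth and t = D / g^2.

    The Stein kernel is a product over the coordinates of Gaussian factors
    times a sum over the coordinates of quadratic polynomials. Reweighting a
    normal law by a Gaussian factor gives a multiple of another normal law,
    and over a product measure the masses multiply while the means and the
    variances of the quadratics add up ([tilted_gaussian]). So only
    one-dimensional Gaussian moments are needed, and every moment of the
    kernel has a closed form ([moment_ratio_ksd]):
    - the common mean of the kernel and of its conditional expectation has
      square B M^2, with B = (g / (g + 2))^D;
    - the mean square of the kernel is
      G ((M + D delta)^2 + 2 M + D eta), with G = (g / (g + 4))^(D/2),
      delta close to 1 / g and eta close to 1;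
    - the mean square of the conditional expectation is A (M^2 + c M), with
      A = (g^2 / ((g + 1) (g + 3)))^(D/2) and c close to 1.

    The prefactors separate into two effects. The quotient
    G / A = (1 + 3 / (g (g + 4)))^(D/2) is exp (2 L), where L
    ([log_factor]) differs from 3 t / 4 by at most 3 t / g
    ([log_factor_approx]); it is the exponential of the first regime and is
    bounded in the two others. The subtracted squared means leave the factors
    1 - B / A and 1 - B / G in front of M^2, and both are comparable with
    tau = t / (1 + t) ([defect_bounds]). Hence, already for g >= 2, the
    squared ratio is exp (2 L) times
      (tau M^2 + M D / g + (D / g)^2 + M + D) / (tau M^2 + M)
    up to a factor 64 ([moment_ratio_bounds]).

    The three regimes are the three possible sizes of t. If t is bounded
    below, then so is tau and the denominator is of order M^2
    ([rate_small_bandwidth], which serves the first and the third regime); if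
    t tends to 0, then tau is of order t ([rate_large_bandwidth]). The mixed
    terms are geometric means of the other ones, so they never change the
    order of magnitude. *)

(** * Integrals with a known value *)

(** Integrability and value are kept together, so that a linear combination or
    a product of integrals needs no separate integrability argument. *)
Definition has_integral (d : measure_display) (T : measurableType d) (R : realType)
    (m : {measure set T -> \bar R}) (f : T -> R) (r : R) : Prop :=
  m.-integrable [set: T] (EFin \o f) /\ (\int[m]_x (f x)%:E = r%:E)%E.

Section has_integral.
Context {d : measure_display} {T : measurableType d} {R : realType}.
Implicit Types (f g : T -> R) (m : {measure set T -> \bar R}).

Lemma has_integral_measurable m f r : has_integral m f r -> measurable_fun [set: T] f.
Proof. by move=> [fi _]; apply/measurable_EFinP; exact: (measurable_int m). Qed.

Lemma eq_has_integral m f g r : f =1 g -> has_integral m g r -> has_integral m f r.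
Proof. by move=> /funext ->. Qed.

Lemma has_integralZ m k f r : has_integral m f r -> has_integral m (fun x => k * f x) (k * r).
Proof.
move=> [fi fr]; split.
  exact: (integrableZl measurableT k fi).
under eq_integral do rewrite EFinM.
by rewrite integralZl// fr EFinM.
Qed.

Lemma has_integralD m f g r s : has_integral m f r -> has_integral m g s ->
  has_integral m (fun x => f x + g x) (r + s).
Proof.
move=> [fi fr] [gi gs]; split.
  exact: (integrableD measurableT fi gi).
under eq_integral do rewrite EFinD.
by rewrite integralD_EFin// fr gs EFinD.
Qed.

Lemma has_integral_cst (P : probability T R) (k : R) : has_integral P (fun=> k) k.
Proof.
split; last first.
  have := @integral_cst _ _ _ P setT measurableT k%:E.
  by rewrite [X in (_ * X)%E]probability_setT mule1.
exact: finite_measure_integrable_cst.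
Qed.

Lemma has_integral_ge0 m f r : measurable_fun [set: T] f -> (forall x, 0 <= f x) ->
  (\int[m]_x (f x)%:E = r%:E)%E -> has_integral m f r.
Proof.
move=> mf f0 fr; split => //; apply/integrableP; split.
  exact/measurable_EFinP.
under eq_integral do rewrite /= ger0_norm//.
by rewrite fr ltry.
Qed.

Lemma has_integral_dist {d' : measure_display} {T' : measurableType d'}
    (P : probability T R) (X : {mfun T >-> T'}) (f : T' -> R) (r : R) :
  measurable_fun [set: T'] f -> has_integral P (f \o X) r ->
  has_integral (distribution P X) f r.
Proof.
move=> mf [fi fr]; have mf' := (measurable_EFinP setT f).2 mf; split.
  by apply: integrable_pushforward => //; rewrite preimage_setT.
by rewrite integral_distribution.
Qed.

End has_integral.

Section has_integral_prod.
Context {d1 d2 : measure_display} {T1 : measurableType d1}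
  {T2 : measurableType d2} {R : realType}.
Variables (P1 : probability T1 R) (P2 : probability T2 R).

Lemma has_integral_prod (f : T1 -> R) (g : T2 -> R) (r s : R) :
  has_integral P1 f r -> has_integral P2 g s ->
  has_integral (P1 \x P2)%E (fun z => f z.1 * g z.2) (r * s).
Proof.
move=> fr gs.
have mfg : measurable_fun setT (EFin \o (fun z : T1 * T2 => f z.1 * g z.2)).
  apply/measurable_EFinP; apply: measurable_funM.
    exact: measurableT_comp (has_integral_measurable fr) measurable_fst.
  exact: measurableT_comp (has_integral_measurable gs) measurable_snd.
have ifg : (P1 \x P2)%E.-integrable setT (EFin \o (fun z => f z.1 * g z.2)).
  apply/integrable12ltyP => //=.
  have -> : (fun x => \int[P2]_y `|(f x * g y)%:E|)%E =
      (fun x => `|(f x)%:E| * \int[P2]_y `|(g y)%:E|)%E.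
    apply/funext => x; rewrite -ge0_integralZl//.
      by apply: eq_integral => y _; rewrite -abseM.
    apply: measurableT_comp => //; apply/measurable_EFinP.
    exact: has_integral_measurable gs.
  case: fr gs => fi fr [gi gs].
  have /integrableP[mf ltf] := fi; have /integrableP[mg ltg] := gi.
  rewrite ge0_integralZr//=; last 2 first.
  - by apply/measurable_EFinP; apply: measurableT_comp => //; exact/measurable_EFinP.
  - exact: integral_ge0.
  by apply: lte_mul_pinfty => //; [exact: integral_ge0|
    rewrite ge0_fin_numE//; exact: integral_ge0].
split => //; rewrite -integral12_prod_meas1//= /fubini_F/=.
have -> : (fun x => \int[P2]_y ((f x * g y)%:E))%E =
    (fun x => (s * f x)%:E)%E.
  by apply/funext => x; have [_ ->] := has_integralZ (f x) gs; rewrite mulrC.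
by have [_ ->] := has_integralZ s fr; rewrite mulrC.
Qed.

End has_integral_prod.

(** * Reweighted product measures *)

(** The mass [a] of the measure of density [W] with respect to [m], and the mean
    [b] and the variance [v] of [S] under that measure normalised by [a]. *)
Definition tilted (d : measure_display) (T : measurableType d) (R : realType)
    (m : {measure set T -> \bar R}) (W S : T -> R) (a b v : R) : Prop :=
  [/\ has_integral m W a, has_integral m (fun x => W x * S x) (a * b) &
      has_integral m (fun x => W x * S x ^+ 2) (a * (b ^+ 2 + v))].

(** Under the normalised product weight, [S1] and [S2] are independent: the mass
    is multiplicative, the mean and the variance of the sum are additive. *)
Lemma tilted_prod {d1 d2 : measure_display} {T1 : measurableType d1}
    {T2 : measurableType d2} {R : realType}
    {P1 : probability T1 R} {P2 : probability T2 R}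
    {W1 S1 : T1 -> R} {W2 S2 : T2 -> R} {a1 b1 v1 a2 b2 v2 : R} :
  tilted P1 W1 S1 a1 b1 v1 -> tilted P2 W2 S2 a2 b2 v2 ->
  tilted (P1 \x P2)%E (fun z => W1 z.1 * W2 z.2) (fun z => S1 z.1 + S2 z.2)
    (a1 * a2) (b1 + b2) (v1 + v2).
Proof.
move=> [A1 B1 C1] [A2 B2 C2]; split; first exact: (has_integral_prod A1 A2).
  have -> : (fun z => W1 z.1 * W2 z.2 * (S1 z.1 + S2 z.2)) =
    (fun z => (W1 z.1 * S1 z.1) * W2 z.2 + W1 z.1 * (W2 z.2 * S2 z.2)).
    by apply/funext => z; ring.
  have -> : a1 * a2 * (b1 + b2) = (a1 * b1) * a2 + a1 * (a2 * b2) by ring.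
  exact: (has_integralD (has_integral_prod B1 A2) (has_integral_prod A1 B2)).
have -> : (fun z => W1 z.1 * W2 z.2 * (S1 z.1 + S2 z.2) ^+ 2) =
  (fun z => (W1 z.1 * S1 z.1 ^+ 2) * W2 z.2 +
     2 * ((W1 z.1 * S1 z.1) * (W2 z.2 * S2 z.2)) +
     W1 z.1 * (W2 z.2 * S2 z.2 ^+ 2)).
  by apply/funext => z; ring.
have -> : a1 * a2 * ((b1 + b2) ^+ 2 + (v1 + v2)) =
    (a1 * (b1 ^+ 2 + v1)) * a2 + 2 * ((a1 * b1) * (a2 * b2)) +
    a1 * (a2 * (b2 ^+ 2 + v2)) by ring.
apply: has_integralD (has_integral_prod A1 C2).
exact: has_integralD (has_integral_prod C1 A2) (has_integralZ 2 (has_integral_prod B1 B2)).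
Qed.

Lemma tilted_gaussian {R : realType} {d : nat} (mu : 'rV[R]_d)
    (w s : 'I_d -> R -> R) (a b v : 'I_d -> R) :
  (forall i, measurable_fun [set: R] (s i)) ->
  (forall i, tilted (normal_prob (mu ord0 i) 1) (w i) (s i) (a i) (b i) (v i)) ->
  tilted (gaussian mu)
    (fun x => \prod_(i < d) w i (x ord0 i))
    (fun x => \sum_(i < d) s i (x ord0 i))
    (\prod_i a i) (\sum_i b i) (\sum_i v i).
Proof.
elim: d => [|d IH] in mu w s a b v * => ms H.
  rewrite !big_ord0 /tilted mul1r addr0.
  split; [apply: eq_has_integral (has_integral_cst _ _) => x|
    apply: eq_has_integral (has_integral_cst _ _) => x|
    apply: eq_has_integral (has_integral_cst _ _) => x]; by rewrite !big_ord0; ring.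
have mw i : measurable_fun setT (w i).
  by have [/has_integral_measurable] := H i.
have mWx : measurable_fun setT
    (fun x : 'rV[R]_d.+1 => \prod_(i < d.+1) w i (x ord0 i)).
  apply: measurable_prod => i _.
  exact: measurableT_comp (mw i) (measurable_rV_coord i).
have mSx : measurable_fun setT
    (fun x : 'rV[R]_d.+1 => \sum_(i < d.+1) s i (x ord0 i)).
  apply: measurable_sum => i.
  exact: measurableT_comp (ms i) (measurable_rV_coord i).
have W i : tilted (normal_prob (col' ord0 mu ord0 i) 1) (w (lift ord0 i))
    (s (lift ord0 i)) (a (lift ord0 i)) (b (lift ord0 i)) (v (lift ord0 i)).
  by rewrite mxE; exact: H.
have [A B C] := tilted_prod (H ord0)
  (IH (col' ord0 mu) _ _ _ _ _ (fun i => ms (lift ord0 i)) W).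
have WE z : \prod_(i < d.+1) w i (@rV_cons R d z ord0 i) =
    w ord0 z.1 * \prod_(i < d) w (lift ord0 i) (z.2 ord0 i).
  rewrite big_ord_recl !mxE unlift_none; congr (_ * _).
  by apply: eq_bigr => i _; rewrite !mxE liftK.
have SE z : \sum_(i < d.+1) s i (@rV_cons R d z ord0 i) =
    s ord0 z.1 + \sum_(i < d) s (lift ord0 i) (z.2 ord0 i).
  rewrite big_ord_recl !mxE unlift_none; congr (_ + _).
  by apply: eq_bigr => i _; rewrite !mxE liftK.
rewrite /tilted !big_ord_recl; split; apply: has_integral_dist.
- exact: mWx.
- by apply: eq_has_integral A => z; rewrite /= WE.
- exact: measurable_funM.
- by apply: eq_has_integral B => z; rewrite /= WE SE.
- by apply: measurable_funM => //; exact: measurable_funX.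
- by apply: eq_has_integral C => z; rewrite /= WE SE.
Qed.

(** * One-dimensional normal laws *)

Section normal_density.
Context {R : realType}.
Local Notation mu := (@lebesgue_measure R).

(** The normal density is a Radon-Nikodym derivative, by uniqueness of the
    latter. *)
Lemma normal_prob_density (m s : R) (g : R -> \bar R) :
  measurable_fun [set: R] g ->
  (forall x, 0 <= g x)%E ->
  (\int[normal_prob m s]_x g x = \int[mu]_x (g x * (normal_pdf m s x)%:E))%E.
Proof.
move=> mg g0; have dom := normal_prob_dominates m s.
rewrite -(Radon_Nikodym_SigmaFinite.change_of_variables dom g0)//.
have fi := Radon_Nikodym_SigmaFinite.f_integrable dom.
apply: ae_eq_integral => //.
- by apply: emeasurable_funM => //; exact: (measurable_int mu).
- apply: emeasurable_funM => //.
  by apply/measurable_EFinP; exact: measurable_normal_pdf.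
apply: ae_eqe_mul2l; apply: integral_ae_eq => //.
  by apply/measurable_EFinP; exact: measurable_normal_pdf.
by move=> E _ mE; rewrite -(Radon_Nikodym_SigmaFinite.f_integral dom).
Qed.

Lemma has_integral_normal (m s : R) (f : R -> R) r : measurable_fun [set: R] f ->
  has_integral mu (fun x => f x * normal_pdf m s x) r ->
  has_integral (normal_prob m s) f r.
Proof.
move=> mf [fi fr]; pose p := normal_pdf m s.
have p0 x : 0 <= p x := normal_pdf_ge0 m s x.
have mE (g : R -> R) : measurable_fun [set: R] g ->
  (forall x, 0 <= g x) ->
  (\int[normal_prob m s]_x (g x)%:E = \int[mu]_x (g x * p x)%:E)%E.
  move=> mg g0; rewrite normal_prob_density//; first exact/measurable_EFinP.
have ifN : (normal_prob m s).-integrable setT (EFin \o f).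
  apply/integrableP; split; first exact/measurable_EFinP.
  have /integrableP[_] := fi; congr (_ < _)%E.
  rewrite mE//; last exact: measurableT_comp.
  by apply: eq_integral => x _; rewrite /= normrM (ger0_norm (p0 x)).
split=> //.
have pos : measurable_fun [set: R] (fun x => `|f x|) by exact: measurableT_comp.
have E1 := mE (fun x => f x + `|f x|) (measurable_funD mf pos) _.
have E2 := mE (fun x => `|f x|) pos (fun=> normr_ge0 _).
have aN : has_integral (normal_prob m s) (fun x => `|f x|)
    (fine (\int[normal_prob m s]_x (`|f x|)%:E)%E).
  have ia := integrable_norm ifN.
  by split=> //; rewrite fineK//; exact: integrable_fin_num ia.
have aL : has_integral mu (fun x => `|f x| * p x)
    (fine (\int[normal_prob m s]_x (`|f x|)%:E)%E).
  have [ia ra] := aN; split; last by rewrite -E2.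
  have := integrable_norm fi; congr (_.-integrable _ _).
  by apply/funext => x /=; rewrite normrM (ger0_norm (p0 x)).
have fN : has_integral (normal_prob m s) f
    (fine (\int[normal_prob m s]_x (f x)%:E)%E).
  by split=> //; rewrite fineK//; exact: integrable_fin_num ifN.
(* The formula for nonnegative functions is applied to |f| and to f + |f|. *)
have [_ S1] := has_integralD fN aN.
have [_ S2] := has_integralD (conj fi fr) aL.
have : (fine (\int[normal_prob m s]_x (f x)%:E)%E) = r.
  apply: (addIr (fine (\int[normal_prob m s]_x (`|f x|)%:E)%E)).
  apply: EFin_inj; rewrite -S1 -S2 E1; last first.
    by move=> x; rewrite -lerBlDl sub0r ler_normr lexx orbT.
  by apply: eq_integral => x _; rewrite mulrDl.
by move=> <-; case: fN.
Qed.

(** The integral of a derivative over [-n, n] is a difference of two values of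
    the primitive, which is O(1/n) when x F(x) is bounded. *)
Lemma has_integral_derive0 (F f : R -> R) (C : R) :
  continuous f -> (forall x : R, is_derive x (1 : R) F (f x)) ->
  mu.-integrable [set: R] (EFin \o f) ->
  (forall x, `|x| * `|F x| <= C) -> has_integral mu f 0.
Proof.
move=> cf dF fi FC; split => //.
pose I n := `[- (n.+1%:R : R), n.+1%:R].
have cF : continuous F.
  move=> x; apply: differentiable_continuous; apply/derivable1_diffP.
  by have [] := dF x.
have IE n : (\int[mu]_(x in [set` I n]) (f x)%:E =
    (F n.+1%:R - F (- n.+1%:R))%:E)%E.
  rewrite EFinB; apply: continuous_FTC2.
  - by rewrite -subr_gt0 opprK addr_gt0.
  - exact: continuous_subspaceT.
  - split; first by move=> x _; have [] := dF x.
      by apply: cvg_at_right_filter; exact: cF.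
    by apply: cvg_at_left_filter; exact: cF.
  - by move=> x _; rewrite derive1E; have [] := dF x.
have [] := @dominated_convergence _ _ _ mu setT measurableT
  (fun n => (EFin \o f) \_ [set` I n]) (EFin \o f) (abse \o (EFin \o f)).
- move=> n; apply/(measurable_restrictT _ _).1 => //.
  by apply: measurable_funTS; exact: (measurable_int mu).
- exact: (measurable_int mu).
- apply: aeW => x _ /=.
  apply: cvg_near_cst; near=> n; rewrite patchE mem_set//=.
  rewrite in_itv/= -ler_norml.
  near: n; exists (Num.truncn `|x|) => // n /= xn.
  by rewrite ltW// (lt_le_trans (truncnS_gt _))// ler_nat.
- exact: integrable_abse.
- apply: aeW => x n _; rewrite patchE; case: ifP => //= _.
  by rewrite normr0 lee_fin.
move=> _ _ /= cvI.
have : (fun n => \int[mu]_x ((EFin \o f) \_ [set` I n]) x)%E @ \oo --> 0%E.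
  under eq_fun do rewrite -integral_mkcond IE.
  apply: cvg_EFin; first by apply: nearW.
  rewrite /comp/=.
  have h0 : (fun n : nat => (2 * C) * (n.+1%:R)^-1) @ \oo --> (0 : R).
    rewrite -[X in _ --> X](mulr0 (2 * C)); apply: cvgMl_tmp.
    exact: cvg_harmonic.
  apply/norm_cvg0P; apply: (squeeze_cvgr _ (cvg_cst 0) h0).
  near=> n; rewrite normr_ge0/= (le_trans (ler_normB _ _))//.
  rewrite ler_pdivlMr// mulrDl.
  have := FC n.+1%:R; have := FC (- n.+1%:R).
  rewrite normrN (ger0_norm (ler0n _ _)); lra.
by move=> c0; apply/esym; apply: (cvg_unique _ c0 cvI).
Unshelve. all: by end_near. Qed.

End normal_density.

Section normal_moments.
Context {R : realType}.
Local Notation mu := (@lebesgue_measure R).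
Variables (m s : R).
Hypothesis s0 : s != 0.

(** Doubling the standard deviation leaves room for any polynomial factor: this
    gives integrability of the moments up to order 4 and boundedness of
    x^k times the density at once. *)
Lemma normal_pdf_heavier (x : R) :
  (1 + x ^+ 2) ^+ 2 * normal_pdf m s x <=
  (2 * (1 + 2 * m ^+ 2 + 16 * s ^+ 2) ^+ 2) * normal_pdf m (2 * s) x.
Proof.
have s20 : 0 < s ^+ 2 by rewrite exprn_even_gt0.
have ss0 : 2 * s != 0 by rewrite mulf_neq0.
pose e (k : R) := expR (- (x - m) ^+ 2 / (s ^+ 2 *+ 2) * k).
rewrite !normal_pdfE// /normal_pdf /normal_peak.
have -> : (2 * s) ^+ 2 * pi *+ 2 = 2 ^+ 2 * (s ^+ 2 * pi *+ 2) :> R by ring.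
rewrite sqrtrM ?sqr_ge0// sqrtr_sqr ger0_norm// invfM.
set N := (Num.sqrt _)^-1; have N0 : 0 <= N by rewrite invr_ge0.
(* In terms of y the two densities are exp (-4 y) and exp (-y), up to constants. *)
set y := (x - m) ^+ 2 / (8 * s ^+ 2) * 1.
have y0 : 0 <= y by rewrite /y mulr1 divr_ge0 ?sqr_ge0// mulr_ge0// ltW.
have -> : normal_fun m s x = expR (- y) * (expR (- y) * expR (- y)) * expR (- y).
  by rewrite -!expRD /normal_fun; congr expR; rewrite /y; field.
have -> : normal_fun m (2 * s) x = expR (- y).
  by rewrite /normal_fun; congr expR; rewrite /y; field.
set E := expR (- y).
have E0 : 0 < E := expR_gt0 _.
have Ey : (1 + y) * E <= 1.
  by rewrite /E expRN ler_pdivrMr ?expR_gt0// mul1r expR_ge1Dx.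
have E1 : E <= 1 by rewrite /E -[leRHS]expR0 ler_expR oppr_le0.
set K := (1 + _ + _).
have xK : 1 + x ^+ 2 <= K * (1 + y).
  have : (x - m) ^+ 2 = 8 * s ^+ 2 * y by rewrite /y; field.
  have := sqr_ge0 (x - 2 * m); rewrite /K !expr2 => h1 h2.
  have : 0 <= m * m * y by rewrite mulr_ge0// -expr2 sqr_ge0.
  have : 0 <= s * s * y by rewrite mulr_ge0// -expr2 sqr_ge0.
  have : 0 <= s * s by rewrite -expr2 sqr_ge0.
  lra.
have K0 : 0 < K by rewrite /K; have := sqr_ge0 m; lra.
have A : (1 + x ^+ 2) * E <= K.
  rewrite (le_trans (ler_wpM2r (ltW E0) xK))// -mulrA ler_piMr// ltW//.
have A0 : 0 <= (1 + x ^+ 2) * E by rewrite mulr_ge0 ?addr_ge0 ?sqr_ge0// ltW.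
have A2 : ((1 + x ^+ 2) * E) ^+ 2 <= K ^+ 2 by rewrite ler_pXn2r ?nnegrE// ltW.
have -> : (1 + x ^+ 2) ^+ 2 * (N * (E * (E * E) * E)) =
  ((1 + x ^+ 2) * E) ^+ 2 * (E * (N * E)) by ring.
have -> : 2 * K ^+ 2 * (2^-1 / Num.sqrt (s ^+ 2 * pi *+ 2) * E) =
  K ^+ 2 * (1 * (N * E)) by rewrite -/N; field.
apply: ler_pM => //; first exact: sqr_ge0.
  by rewrite !mulr_ge0// ltW.
by rewrite ler_wpM2r// mulr_ge0// ltW.
Qed.

Let K := 2 * (1 + 2 * m ^+ 2 + 16 * s ^+ 2) ^+ 2.

Lemma is_derive_normal_pdf (x : R) :
  is_derive x (1 : R) (normal_pdf m s) (- ((x - m) / s ^+ 2) * normal_pdf m s x).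
Proof.
rewrite normal_pdfE//.
apply: is_derive_eq; rewrite /GRing.scale/= /normal_fun; field.
by [].
Qed.

Lemma continuous_poly_normal (k : nat) :
  continuous (fun x : R => x ^+ k * normal_pdf m s x).
Proof.
move=> x; apply: cvgM; first exact: exprn_continuous.
exact: continuous_normal_pdf.
Qed.

Let pow_bound (k : nat) (x : R) : (k <= 4)%N -> `|x| ^+ k <= (1 + x ^+ 2) ^+ 2.
Proof.
move=> k4; have [x1|x1] := leP `|x| 1.
  rewrite (@le_trans _ _ 1)// ?exprn_ile1//.
  by rewrite exprn_ege1// lerDl sqr_ge0.
rewrite (@le_trans _ _ (`|x| ^+ 4))//; first by apply: ler_weXn2l => //; exact: ltW.
rewrite (exprM `|x| 2 2) real_normK ?num_real// ler_pXn2r ?nnegrE ?addr_ge0 ?sqr_ge0//.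
by rewrite lerDr.
Qed.

Lemma integrable_normal_moment (k : nat) : (k <= 4)%N ->
  mu.-integrable setT (EFin \o (fun x : R => x ^+ k * normal_pdf m s x)).
Proof.
move=> k4; have iK := integrableZl measurableT K (integrable_normal_pdf m (2 * s)).
apply: le_integrable iK => //.
  apply/measurable_EFinP; apply: measurable_funM; first exact: measurable_funX.
  exact: measurable_normal_pdf.
move=> x _; rewrite lee_fin [leRHS]ger0_norm.
  rewrite normrM normrX (ger0_norm (normal_pdf_ge0 _ _ _)).
  rewrite (le_trans _ (normal_pdf_heavier x))// ler_wpM2r ?normal_pdf_ge0//.
  exact: pow_bound.
by rewrite mulr_ge0 ?normal_pdf_ge0// mulr_ge0// sqr_ge0.
Qed.

(** Stein's identity for x^k: the derivative of x^k times the density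
    integrates to 0. *)
Lemma normal_moment_rec (k : nat) (a b : R) : (k <= 3)%N ->
  has_integral mu (fun x : R => x ^+ k * normal_pdf m s x) a ->
  has_integral mu (fun x : R => x ^+ k.-1 * normal_pdf m s x) b ->
  has_integral mu (fun x : R => x ^+ k.+1 * normal_pdf m s x) (m * a + s ^+ 2 * k%:R * b).
Proof.
move=> k3 ha hb; pose p := normal_pdf m s.
pose f x := k%:R * (x ^+ k.-1 * p x) + (m / s ^+ 2) * (x ^+ k * p x)
  - (s ^+ 2)^-1 * (x ^+ k.+1 * p x).
have df (x : R) : is_derive x (1 : R) (fun x : R => x ^+ k * p x) (f x).
  have dp := is_derive_normal_pdf x.
  have dX : is_derive x (1 : R) (fun x : R => x ^+ k) (k%:R * x ^+ k.-1).
    apply: DeriveDef; first exact: exprn_derivable.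
    by rewrite exp_derive /GRing.scale/= mulr1.
  apply: (is_derive_eq (is_deriveM dX dp)); rewrite /GRing.scale/= /f (exprS x k) -/p.
  field.
  by [].
have cf : continuous f.
  move=> x; apply: cvgB; first apply: cvgD.
  - by apply: cvgMl_tmp; exact: continuous_poly_normal.
  - by apply: cvgMl_tmp; exact: continuous_poly_normal.
  - by apply: cvgMl_tmp; exact: continuous_poly_normal.
have hk : mu.-integrable setT (EFin \o (fun x : R => x ^+ k.+1 * p x)).
  exact: integrable_normal_moment.
(* The value of the next moment is not known yet; only its existence is used
   here, to see that the derivative is integrable. *)
have hc : has_integral mu (fun x : R => x ^+ k.+1 * p x)
    (fine (\int[mu]_x (x ^+ k.+1 * p x)%:E)%E).
  by split=> //; rewrite fineK//; exact: (integrable_fin_num measurableT hk).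
have hf := has_integralD (has_integralD (has_integralZ k%:R hb) (has_integralZ (m / s ^+ 2) ha))
  (has_integralZ (- (s ^+ 2)^-1) hc).
have fi : mu.-integrable setT (EFin \o f).
  case: (hf) => + _; congr (_.-integrable _ _).
  by apply/funext => x /=; rewrite /f mulNr.
have f0 : has_integral mu f 0.
  apply: (@has_integral_derive0 _ _ _ (K * normal_peak (2 * s))) df fi _ => // x.
  rewrite normrM normrX mulrA -exprS (ger0_norm (normal_pdf_ge0 _ _ _)).
  rewrite (@le_trans _ _ ((1 + x ^+ 2) ^+ 2 * p x))//.
    by rewrite ler_wpM2r ?normal_pdf_ge0// pow_bound.
  rewrite (le_trans (normal_pdf_heavier x))// ler_wpM2l//.
    by rewrite mulr_ge0// sqr_ge0.
  by apply: normal_pdf_ub; rewrite mulf_neq0.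
have -> : m * a + s ^+ 2 * k%:R * b =
  s ^+ 2 * (k%:R * b + m / s ^+ 2 * a + - 1 * 0) by field.
apply: eq_has_integral (has_integralZ (s ^+ 2) (has_integralD (has_integralD (has_integralZ k%:R hb)
  (has_integralZ (m / s ^+ 2) ha)) (has_integralZ (-1) f0))) => x.
rewrite /f -/p; field.
by [].
Qed.

Lemma has_integral_normal_quartic (c0 c1 c2 c3 c4 : R) :
  has_integral mu (fun x : R => (c0 + c1 * x + c2 * x ^+ 2 + c3 * x ^+ 3 + c4 * x ^+ 4)
      * normal_pdf m s x)
    (c0 + c1 * m + c2 * (m ^+ 2 + s ^+ 2) + c3 * (m ^+ 3 + 3 * m * s ^+ 2)
     + c4 * (m ^+ 4 + 6 * m ^+ 2 * s ^+ 2 + 3 * s ^+ 4)).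
Proof.
have h0 : has_integral mu (fun x : R => x ^+ 0 * normal_pdf m s x) 1.
  split; first exact: integrable_normal_moment.
  by under eq_integral do rewrite expr0 mul1r; exact: integral_normal_pdf.
have h1 := normal_moment_rec (isT : (0 <= 3)%N) h0 h0.
have h2 := normal_moment_rec (isT : (1 <= 3)%N) h1 h0.
have h3 := normal_moment_rec (isT : (2 <= 3)%N) h2 h1.
have h4 := normal_moment_rec (isT : (3 <= 3)%N) h3 h2.
have := has_integralD (has_integralD (has_integralD (has_integralD (has_integralZ c0 h0) (has_integralZ c1 h1))
  (has_integralZ c2 h2)) (has_integralZ c3 h3)) (has_integralZ c4 h4).
set r1 := (X in has_integral _ _ X -> _); set r2 := (X in _ -> has_integral _ _ X).
have -> : r1 = r2 by rewrite /r1 /r2; ring.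
by apply: eq_has_integral => x; ring.
Qed.

End normal_moments.

Section tilted_normal.
Context {R : realType}.
Local Notation mu := (@lebesgue_measure R).

(** Completing the square: exp (- l (x - t)^2) times the density of N(m, 1) is a
    multiple of the density of N(m', V). Under N(m', V) the polynomial is a
    linear plus a centred quadratic term, which are uncorrelated; hence the two
    terms of the variance. *)
Lemma tilted_normal_quadratic (l t m al be ka : R) : 0 <= l ->
  let V := (1 + 2 * l)^-1 in
  let m' := V * (m + 2 * l * t) in
  tilted (normal_prob m 1) (fun x => expR (- (l * (x - t) ^+ 2)))
    (fun x => al * x ^+ 2 + be * x + ka)
    (Num.sqrt V * expR (- (l * V * (t - m) ^+ 2)))
    (al * (m' ^+ 2 + V) + be * m' + ka)
    (V * (be + 2 * al * m') ^+ 2 + 2 * al ^+ 2 * V ^+ 2).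
Proof.
move=> l0 V m'; have V0 : 0 < V by rewrite invr_gt0; lra.
pose s := Num.sqrt V; have s0 : s != 0 by rewrite gt_eqF// sqrtr_gt0.
have s2 : s ^+ 2 = V by rewrite sqr_sqrtr// ltW.
set K := _ * expR _.
have pdfE x : expR (- (l * (x - t) ^+ 2)) * normal_pdf m 1 x =
    K * normal_pdf m' s x.
  pose N : R := (Num.sqrt (pi *+ 2))^-1.
  have N1 : normal_peak (1 : R) = N.
    by rewrite /normal_peak expr1n mul1r.
  have Ns : normal_peak s = N / s.
    rewrite /normal_peak s2 -mulrnAr sqrtrM; last exact: ltW.
    by rewrite -/s invfM mulrC.
  rewrite !normal_pdfE ?oner_eq0// N1 Ns /K -/s.
  have -> : s * expR (- (l * V * (t - m) ^+ 2)) * (N / s * normal_fun m' s x) =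
      N * (expR (- (l * V * (t - m) ^+ 2)) * normal_fun m' s x) by field.
  rewrite mulrCA; congr (_ * _).
  rewrite /normal_fun -!expRD; congr expR; rewrite s2 /m' /V.
  field.
  by rewrite gt_eqF//; lra.
have H (c0 c1 c2 c3 c4 : R) (f : R -> R) r :
    (forall x, f x = c0 + c1 * x + c2 * x ^+ 2 + c3 * x ^+ 3 + c4 * x ^+ 4) ->
    (r = c0 + c1 * m' + c2 * (m' ^+ 2 + V) + c3 * (m' ^+ 3 + 3 * m' * V)
     + c4 * (m' ^+ 4 + 6 * m' ^+ 2 * V + 3 * V ^+ 2)) ->
  has_integral (normal_prob m 1) (fun x => expR (- (l * (x - t) ^+ 2)) * f x) (K * r).
  move=> /funext -> ->; apply: has_integral_normal.
    apply: measurable_funM.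
      do 2!(apply: measurableT_comp => //); apply: measurable_funM => //.
      by apply: measurable_funX => //; exact: measurable_funB.
    do 4!(apply: measurable_funD;
      last by apply: measurable_funM => //; exact: measurable_funX).
    exact: measurable_cst.
  have := has_integralZ K (has_integral_normal_quartic m' s0 c0 c1 c2 c3 c4).
  have s4 : s ^+ 4 = V ^+ 2 by rewrite -s2 -exprM.
  rewrite s4 s2.
  by apply: eq_has_integral => x; rewrite mulrAC pdfE; ring.
split.
- have := H 1 0 0 0 0 (fun=> 1) 1; rewrite mulr1 => h.
  by apply: eq_has_integral (h _ _) => [x||]; [|move=> x|]; ring.
- apply: (H ka be al 0 0) => [x|]; ring.
- apply: (H (ka ^+ 2) (2 * be * ka) (be ^+ 2 + 2 * al * ka) (2 * al * be) (al ^+ 2)) => [x|]; ring.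
Qed.

End tilted_normal.

(** * Moments of a function of an i.i.d. pair *)

Section variance.
Context {d : measure_display} {T : measurableType d} {R : realType}.

Lemma variance_has_integral (P : probability T R) (X : T -> R) (e1 e2 : R) :
  has_integral P X e1 -> has_integral P (fun x => X x ^+ 2) e2 ->
  fine ('V_P[X])%E = e2 - e1 ^+ 2.
Proof.
move=> h1 h2; rewrite /variance covariance.unlock.
have E1 : fine ('E_P[X])%E = e1 by rewrite expectation.unlock (h1.2).
rewrite E1 expectation.unlock.
have [_ H] := has_integralD (has_integralD h2 (has_integralZ (- (2 * e1)) h1)) (has_integral_cst P (e1 ^+ 2)).
have -> : (\int[P]_w (((X \- cst e1) * (X \- cst e1)) w)%:E =
   \int[P]_x (X x ^+ 2 + - (2 * e1) * X x + e1 ^+ 2)%:E)%E.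
  apply: eq_integral => x _; congr (_%:E).
  by rewrite (_ : ((X \- cst e1) * (X \- cst e1)) x = (X x - e1) * (X x - e1))//; ring.
by rewrite H /=; ring.
Qed.

Lemma has_integral_ae (m : {measure set T -> \bar R}) (f g : T -> R) r :
  measurable_fun [set: T] f -> ae_eq m [set: T] (EFin \o f) (EFin \o g) ->
  has_integral m g r -> has_integral m f r.
Proof.
move=> mf fg [gi gr]; have mf' := (measurable_EFinP setT f).2 mf.
have mg := measurable_int m gi; split.
  apply/integrableP; split=> //; have /integrableP[_] := gi.
  congr (_ < _)%E; apply: ae_eq_integral => //; try exact: measurableT_comp.
  by apply: filterS fg => x /= h /h [->].
by rewrite -gr; exact: ae_eq_integral.
Qed.

End variance.

Section second_moments.
Context {d : measure_display} {T : measurableType d} {R : realType}.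

Lemma fubini_slice (Q : probability T R) (u : T -> T -> R) (g : T -> R)
    (A : set T) :
  (Q \x Q)%E.-integrable [set: T * T] (EFin \o (fun w => u w.1 w.2)) ->
  (forall x, has_integral Q (u x) (g x)) -> measurable A ->
  (\int[(Q \x Q)%E]_(w in fst @^-1` A) (u w.1 w.2)%:E =
   \int[Q]_(x in A) (g x)%:E)%E.
Proof.
move=> ui ug mA; have mfA : measurable (@fst T T @^-1` A).
  by rewrite -[X in measurable X]setTI; exact: measurable_fst.
rewrite integral_mkcond -integral12_prod_meas1; last first.
  apply/integrable_restrict => //; rewrite setTI.
  by apply: integrableS ui => //; exact: subsetT.
rewrite [RHS]integral_mkcond; apply: eq_integral => x _.
rewrite /fubini_F patchE; case: ifPn => xA.
  rewrite -(ug x).2; apply: eq_integral => y _.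
  by rewrite patchE ifT// inE/=; exact: set_mem.
apply: integral0_eq => y _; rewrite patchE ifF//.
by apply/negbTE; move: xA; apply: contra; rewrite !inE.
Qed.

Lemma has_integral_fst (Q : probability T R) (f : T -> R) r :
  has_integral Q f r -> has_integral (Q \x Q)%E (fun w : T * T => f w.1) r.
Proof.
move=> fr; rewrite -[r]mulr1.
by apply: eq_has_integral (has_integral_prod fr (has_integral_cst Q 1)) => w; rewrite mulr1.
Qed.

(** Any version of the conditional expectation given the first coordinate is a
    function of that coordinate, and its integrals over slices determine it
    almost everywhere. *)
Lemma cond_exp_fst (Q : probability T R) (u : T -> T -> R) (g : T -> R) (e : R) :
  (Q \x Q)%E.-integrable [set: T * T] (EFin \o (fun w => u w.1 w.2)) ->
  (forall x, has_integral Q (u x) (g x)) -> has_integral Q g e ->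
  exists f : T -> R, [/\ measurable_fun [set: T] f,
    ae_eq Q [set: T] (EFin \o f) (EFin \o g) &
    cond_exp (Q \x Q)%E fst (fun w => u w.1 w.2) = (fun w => f w.1)].
Proof.
move=> ui ug ge; set Z := cond_exp _ _ _.
have [mZ Zi ZE] : is_cond_exp (Q \x Q)%E (@fst T T) (fun w => u w.1 w.2) Z.
  rewrite /Z /cond_exp; apply: getPex; exists (fun w => g w.1).
  have mg := has_integral_measurable ge; split.
  - move=> _ B mB; rewrite setTI; exists (g @^-1` B); last by rewrite setTI.
    by rewrite -[X in measurable X]setTI; exact: mg.
  - by have [] := has_integral_fst ge.
  - move=> A mA; rewrite (fubini_slice ui ug mA).
    rewrite (@fubini_slice Q (fun x _ => g x) g)//.
      by have [] := has_integral_fst ge.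
    by move=> x; exact: has_integral_cst.
have preim (B : set R) : measurable B ->
    exists2 A, measurable A & Z @^-1` B = @fst T T @^-1` A.
  move=> mB; have := mZ measurableT B mB; rewrite setTI => -[A mA].
  by rewrite setTI => <-; exists A.
have Zf w : Z w = Z (w.1, w.1).
  have [A mA AE] := preim [set Z w] (measurable_set1 _).
  have : (@fst T T @^-1` A) w by rewrite -AE.
  move=> wA; have : (@fst T T @^-1` A) (w.1, w.1) by [].
  by rewrite -AE.
(* Z does not depend on the second coordinate, so any point may stand there;
   the diagonal avoids choosing one. *)
pose f x := Z (x, x).
have mf : measurable_fun setT f.
  move=> _ B mB; rewrite setTI; have [A mA AE] := preim B mB.
  rewrite (_ : _ @^-1` _ = A)//; apply/seteqP; split => x /=.
    by rewrite /f => fB; have : (Z @^-1` B) (x, x) by []; rewrite AE.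
  by move=> Ax; have : (@fst T T @^-1` A) (x, x) by []; rewrite -AE.
exists f; split => //; last by apply/funext => w; rewrite Zf.
apply: ae_eq_sym; apply: integral_ae_eq => //.
- by have [] := ge.
- exact/measurable_EFinP.
move=> A _ mA /=; rewrite -(fubini_slice ui ug mA) -ZE//.
rewrite -(@fubini_slice Q (fun x _ => f x) f)//.
- by apply: eq_integral => w _; rewrite Zf.
- by move: Zi; congr (_.-integrable _ _); apply/funext => w /=; rewrite Zf.
- by move=> x; exact: has_integral_cst.
Qed.

Lemma sigma_fullE (Q : probability T R) (u : T -> T -> R) (e1 e2 : R) :
  has_integral (Q \x Q)%E (fun w => u w.1 w.2) e1 ->
  has_integral (Q \x Q)%E (fun w => u w.1 w.2 ^+ 2) e2 ->
  sigma_full Q u = Num.sqrt (e2 - e1 ^+ 2).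
Proof. by move=> h1 h2; rewrite /sigma_full (variance_has_integral h1 h2). Qed.

Lemma sigma_condE (Q : probability T R) (u : T -> T -> R) (g : T -> R) (e1 e2 : R) :
  (Q \x Q)%E.-integrable [set: T * T] (EFin \o (fun w => u w.1 w.2)) ->
  (forall x, has_integral Q (u x) (g x)) ->
  has_integral Q g e1 -> has_integral Q (fun x => g x ^+ 2) e2 ->
  sigma_cond Q u = Num.sqrt (e2 - e1 ^+ 2).
Proof.
move=> ui ug g1 g2; have [f [mf fg ZE]] := cond_exp_fst ui ug g1.
have f2 : has_integral Q (fun x => f x ^+ 2) e2.
  apply: has_integral_ae g2; first exact: measurable_funX.
  by apply: filterS fg => x /= h /h [->].
have f1 := has_integral_ae mf fg g1.
by rewrite /sigma_cond ZE (variance_has_integral (has_integral_fst f1) (has_integral_fst f2)).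
Qed.

(** A finite second moment, computed by iterated integration of a nonnegative
    function, gives the integrability that the first moment requires. *)
Lemma has_integral_iter (Q : probability T R) (u : T -> T -> R) (g : T -> R) (e1 e2 : R) :
  measurable_fun [set: T * T] (fun w => u w.1 w.2) ->
  (forall x, has_integral Q (u x) (g x)) -> has_integral Q g e1 ->
  (\int[Q]_x \int[Q]_y ((u x y) ^+ 2)%:E = e2%:E)%E ->
  has_integral (Q \x Q)%E (fun w => u w.1 w.2) e1 /\
  has_integral (Q \x Q)%E (fun w => u w.1 w.2 ^+ 2) e2.
Proof.
move=> mu ug g1 u2.
have h2 : has_integral (Q \x Q)%E (fun w => u w.1 w.2 ^+ 2) e2.
  apply: has_integral_ge0; first exact: measurable_funX.
    by move=> w; exact: sqr_ge0.
  rewrite fubini_tonelli1//.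
    by apply/measurable_EFinP; exact: measurable_funX.
  by move=> w; rewrite lee_fin sqr_ge0.
have ui : (Q \x Q)%E.-integrable setT (EFin \o (fun w => u w.1 w.2)).
  have [i12 _] := has_integralD (has_integral_cst (Q \x Q)%E 1) h2.
  apply: le_integrable i12 => //; first exact/measurable_EFinP.
  move=> w _; rewrite lee_fin [leRHS]ger0_norm ?addr_ge0 ?sqr_ge0//.
  rewrite -real_normK ?num_real//; have := sqr_ge0 (`|u w.1 w.2| - 1).
  by have := normr_ge0 (u w.1 w.2); nra.
split => //; split => //.
have := fubini_slice ui ug measurableT; rewrite preimage_setT => ->.
by case: g1.
Qed.

End second_moments.

(** * The Stein kernel in closed form *)

Section stein_kernel.
Context {R : realType} {d : nat}.
Implicit Types (x y z : 'rV[R]_d) (i j : 'I_d).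

(** Every derivative below is the derivative of a function of one real variable,
    along a line. *)
Lemma deriveE_line (f : 'rV[R]_d -> R) (v x : 'rV[R]_d) (l : R) :
  is_derive (0 : R) (1 : R) (fun h : R => f (h *: v + x)) l -> 'D_v f x = l.
Proof.
move=> [_ <-]; rewrite /derive; congr (lim _).
have -> : (fun h : R => h^-1 *: ((f \o shift x) (h *: v) - f x)) =
  (fun h : R => h^-1 *: (((fun k : R => f (k *: v + x)) \o shift 0)
    (h *: (1 : R)) - f (0 *: v + x))) by apply/funext => h /=;
  rewrite scale0r add0r /GRing.scale/= mulr1 addr0.
by [].
Qed.

Lemma dot_ge0 x : 0 <= dot x x.
Proof. by apply: sumr_ge0 => i _; rewrite -expr2 sqr_ge0. Qed.

Lemma norm2_sqr x : norm2 x ^+ 2 = \sum_i x ord0 i ^+ 2.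
Proof. by rewrite sqr_sqrtr ?dot_ge0//; apply: eq_bigr => i _; rewrite expr2. Qed.

Lemma norm2_line (h : R) i z :
  norm2 (h *: delta_mx ord0 i + z) ^+ 2 =
  norm2 z ^+ 2 + 2 * h * z ord0 i + h ^+ 2.
Proof.
rewrite 2!norm2_sqr (bigD1 i)//= [in RHS](bigD1 i)//=.
rewrite !mxE !eqxx/= mulr1.
rewrite (eq_bigr (fun j => z ord0 j ^+ 2)); first by ring.
by move=> j ji; rewrite !mxE (negbTE ji) /= mulr0 add0r.
Qed.

Lemma rbf_line (g h : R) i x y :
  rbf g (h *: delta_mx ord0 i + x) y =
  expR (- ((norm2 (x - y) ^+ 2 + 2 * h * (x ord0 i - y ord0 i) + h ^+ 2)
    / (2 * g))).
Proof. by rewrite /rbf -addrA norm2_line !mxE. Qed.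

Lemma rbfC (g : R) x y : rbf g x y = rbf g y x.
Proof.
have E : norm2 (x - y) ^+ 2 = norm2 (y - x) ^+ 2.
  rewrite (norm2_sqr (x - y)) (norm2_sqr (y - x)).
  by apply: eq_bigr => i _; rewrite !mxE -[LHS]sqrrN opprB.
by rewrite /rbf E.
Qed.

Lemma grad1_rbf (g : R) x y i : 0 < g ->
  grad1 (rbf g) x y ord0 i = - (x ord0 i - y ord0 i) / g * rbf g x y.
Proof.
move=> g0; rewrite mxE; apply: deriveE_line.
under eq_fun do rewrite rbf_line.
apply: is_derive_eq; rewrite /GRing.scale/= /rbf.
rewrite mulr0 mul0r addr0 expr0n/= addr0; field.
by rewrite gt_eqF.
Qed.

Lemma grad2_rbf (g : R) x y i : 0 < g ->
  grad2 (rbf g) x y ord0 i = - (y ord0 i - x ord0 i) / g * rbf g x y.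
Proof.
move=> g0; have -> : grad2 (rbf g) x y = grad1 (rbf g) y x.
  have E : (fun z => rbf g x z) = (fun z => rbf g z x).
    by apply/funext => z; exact: rbfC.
  by rewrite /grad1 /grad2 E.
by rewrite (rbfC g x y); exact: grad1_rbf.
Qed.

Lemma grad12_rbf (g : R) x y i : 0 < g ->
  grad12 (rbf g) x y i i =
  (g^-1 - (x ord0 i - y ord0 i) ^+ 2 / g ^+ 2) * rbf g x y.
Proof.
move=> g0; rewrite mxE; apply: deriveE_line.
under eq_fun do rewrite grad2_rbf// rbf_line !mxE !eqxx mulr1.
apply: is_derive_eq; rewrite /GRing.scale/= /rbf.
rewrite mulr0 mul0r addr0 expr0n/= addr0 add0r; field.
by rewrite gt_eqF.
Qed.

Lemma score_gaussian x i : score (gaussian_pdf (0 : 'rV[R]_d)) x ord0 i = - x ord0 i.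
Proof.
have pdfE z : ln (gaussian_pdf (0 : 'rV[R]_d) z) =
    ln (normal_peak (1 : R) ^+ d) - norm2 z ^+ 2 / 2.
  rewrite /gaussian_pdf (eq_bigr (fun j => normal_peak 1 *
      expR (- (z ord0 j ^+ 2 / 2)))); last first.
    move=> j _; rewrite normal_pdfE ?oner_eq0// /normal_fun mxE.
    by congr (_ * expR _); field.
  rewrite big_split/= prodr_const card_ord -expR_sum lnM ?posrE ?expR_gt0//.
    rewrite expRK (norm2_sqr z); congr (_ + _).
    by rewrite sumrN -mulr_suml.
  by rewrite exprn_gt0// normal_peak_gt0 ?oner_eq0.
rewrite mxE; apply: deriveE_line.
under eq_fun do rewrite pdfE norm2_line.
apply: is_derive_eq; rewrite /GRing.scale/=.
field.
by [].
Qed.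

(** The weight is kept as a product over the coordinates, as [tilted_gaussian]
    expects, and is quadratic in [y - x] so that either point can be the
    integration variable. *)
Definition ksd_kernel (g : R) x y : R :=
  (\prod_i expR (- ((2 * g)^-1 * (y ord0 i - x ord0 i) ^+ 2))) *
  \sum_i (x ord0 i * y ord0 i - (g + 1) / g ^+ 2 * (y ord0 i - x ord0 i) ^+ 2
    + g^-1).

Lemma u_ksdE (g : R) x y : 0 < g ->
  u_ksd (gaussian_pdf (0 : 'rV[R]_d)) (rbf g) x y = ksd_kernel g x y.
Proof.
move=> g0; rewrite /ksd_kernel.
have -> : \prod_i expR (- ((2 * g)^-1 * (y ord0 i - x ord0 i) ^+ 2)) = rbf g x y.
  rewrite (rbfC g x y) /rbf -expR_sum (norm2_sqr (y - x)) sumrN; congr expR; congr (- _).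
  by rewrite mulr_suml; apply: eq_bigr => i _; rewrite !mxE mulrC.
have G1 : grad1 (rbf g) x y = \row_i (- (x ord0 i - y ord0 i) / g * rbf g x y).
  by apply/rowP => i; rewrite [RHS]mxE; exact: grad1_rbf.
have G2 : grad2 (rbf g) x y = \row_i (- (y ord0 i - x ord0 i) / g * rbf g x y).
  by apply/rowP => i; rewrite [RHS]mxE; exact: grad2_rbf.
have S z : score (gaussian_pdf (0 : 'rV[R]_d)) z = - z.
  by apply/rowP => i; rewrite [RHS]mxE; exact: score_gaussian.
have T : \tr (grad12 (rbf g) x y) =
    \sum_i (g^-1 - (x ord0 i - y ord0 i) ^+ 2 / g ^+ 2) * rbf g x y.
  by apply: eq_bigr => i _; exact: grad12_rbf.
rewrite /u_ksd G1 G2 !S T; move: (rbf g x y) => k.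
rewrite /dot mulr_suml -!big_split/= mulr_sumr.
apply: eq_bigr => i _; rewrite !mxE; field.
by rewrite gt_eqF.
Qed.

End stein_kernel.

(** * Gaussian moments of the Stein kernel *)

(** The same completion of the square with the polynomial expanded at the mean
    [p] of the reweighted law, where the linear and the quadratic term separate,
    and with an explicit constant in the weight. *)
Lemma tilted_normal_centered {R : realType} (c l t m V p al be ka : R)
    (S : R -> R) :
  0 <= l -> V * (1 + 2 * l) = 1 -> p * (1 + 2 * l) = m + 2 * l * t ->
  (forall x, S x = al * (x - p) ^+ 2 + be * (x - p) + ka) ->
  tilted (normal_prob m 1) (fun x => c * expR (- (l * (x - t) ^+ 2))) S
    (c * (Num.sqrt V * expR (- (l * V * (t - m) ^+ 2))))
    (al * V + ka) (V * be ^+ 2 + 2 * al ^+ 2 * V ^+ 2).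
Proof.
move=> l0 VE pE SE; have l1 : 1 + 2 * l != 0 by rewrite gt_eqF//; lra.
have {}VE : V = (1 + 2 * l)^-1 by apply: (mulIf l1); rewrite VE mulVf.
have {}pE : p = V * (m + 2 * l * t).
  by apply: (mulIf l1); rewrite pE VE [RHS]mulrAC mulVf// mul1r.
have := tilted_normal_quadratic t m al (be - 2 * al * p)
  (al * p ^+ 2 - be * p + ka) l0.
cbv zeta; rewrite -VE -pE => -[A B C].
split.
- exact: has_integralZ.
- have := has_integralZ c B; set r1 := c * _; set r2 := c * _ * _.
  have -> : r1 = r2 by rewrite /r1 /r2; ring.
  by apply: eq_has_integral => x; rewrite SE; ring.
- have := has_integralZ c C; set r1 := c * _; set r2 := c * _ * _.
  have -> : r1 = r2 by rewrite /r1 /r2; ring.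
  by apply: eq_has_integral => x; rewrite SE; ring.
Qed.

Lemma measurable_quadratic {R : realType} (S : R -> R) (al be ka p : R) :
  (forall x, S x = al * (x - p) ^+ 2 + be * (x - p) + ka) ->
  measurable_fun [set: R] S.
Proof.
move=> /funext ->.
apply: measurable_funD => //; apply: measurable_funD.
  apply: measurable_funM => //; apply: measurable_funX.
  exact: measurable_funB.
by apply: measurable_funM => //; exact: measurable_funB.
Qed.

Section ksd_moments.
Context {R : realType} {d : nat}.
Variables (g : R) (mu : 'rV[R]_d).
Hypothesis g0 : 0 < g.
Implicit Types x y : 'rV[R]_d.

Lemma tilted_gaussian_centered (c l al V : R) (t p be ka a b v : 'I_d -> R)
    (S : 'I_d -> R -> R) :
  0 <= l -> V * (1 + 2 * l) = 1 ->
  (forall i, p i * (1 + 2 * l) = mu ord0 i + 2 * l * t i) ->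
  (forall i r, S i r = al * (r - p i) ^+ 2 + be i * (r - p i) + ka i) ->
  (forall i, a i = c * (Num.sqrt V * expR (- (l * V * (t i - mu ord0 i) ^+ 2)))) ->
  (forall i, b i = al * V + ka i) ->
  (forall i, v i = V * be i ^+ 2 + 2 * al ^+ 2 * V ^+ 2) ->
  tilted (gaussian mu)
    (fun x => \prod_i (c * expR (- (l * (x ord0 i - t i) ^+ 2))))
    (fun x => \sum_i S i (x ord0 i))
    (\prod_i a i) (\sum_i b i) (\sum_i v i).
Proof.
move=> l0 VE pE SE aE bE vE.
apply: (tilted_gaussian (w := fun i r => c * expR (- (l * (r - t i) ^+ 2)))).
  by move=> i; exact: measurable_quadratic (SE i).
by move=> i; rewrite aE bE vE; exact: tilted_normal_centered (SE i).
Qed.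

(** The conditional expectation of the kernel given the first point. By Stein's
    identity it vanishes when [mu] is 0. *)
Definition ksd_regression x : R :=
  (\prod_i (Num.sqrt (g / (g + 1)) *
     expR (- ((2 * (g + 1))^-1 * (x ord0 i - mu ord0 i) ^+ 2)))) *
  \sum_i ((g + 2) / (g + 1) * mu ord0 i * (x ord0 i - mu ord0 i)
    + mu ord0 i ^+ 2).

Let gn0 : g != 0. Proof. by rewrite gt_eqF. Qed.
Let g1n0 : g + 1 != 0. Proof. by rewrite gt_eqF// addr_gt0. Qed.
Let g2n0 : g + 2 != 0. Proof. by rewrite gt_eqF// addr_gt0. Qed.
Let g3n0 : g + 3 != 0. Proof. by rewrite gt_eqF// addr_gt0. Qed.
Let g4n0 : g + 4 != 0. Proof. by rewrite gt_eqF// addr_gt0. Qed.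
Let gn := (gn0, g1n0, g2n0, g3n0, g4n0).

Lemma ksd_cond_mean x : has_integral (gaussian mu) (ksd_kernel g x) (ksd_regression x).
Proof.
pose p i := (g * mu ord0 i + x ord0 i) / (g + 1).
pose be i := x ord0 i + 2 * ((g + 1) / g ^+ 2) * (x ord0 i - p i).
pose ka i := x ord0 i * p i - (g + 1) / g ^+ 2 * (p i - x ord0 i) ^+ 2 + g^-1.
have [||i|i y|i|i|i|_ H _] := @tilted_gaussian_centered 1 (2 * g)^-1
  (- ((g + 1) / g ^+ 2)) (g / (g + 1)) (fun i => x ord0 i) p be ka
  (fun i => Num.sqrt (g / (g + 1)) *
     expR (- ((2 * (g + 1))^-1 * (x ord0 i - mu ord0 i) ^+ 2)))
  (fun i => (g + 2) / (g + 1) * mu ord0 i * (x ord0 i - mu ord0 i)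
    + mu ord0 i ^+ 2)
  (fun i => g / (g + 1) * be i ^+ 2 + 2 * (- ((g + 1) / g ^+ 2)) ^+ 2 * (g / (g + 1)) ^+ 2)
  (fun i r => x ord0 i * r - (g + 1) / g ^+ 2 * (r - x ord0 i) ^+ 2 + g^-1).
- by rewrite invr_ge0 ?mulr_ge0 ?addr_ge0 ?ltW.
- by field; rewrite !gn.
- by rewrite /p; field; rewrite !gn.
- by rewrite /be /ka; ring.
- have -> : (2 * g)^-1 * (g / (g + 1)) = (2 * (g + 1))^-1 by field; rewrite !gn.
  by rewrite mul1r.
- by rewrite /ka /p; field; rewrite !gn.
- by [].
apply: eq_has_integral H => y; rewrite /ksd_kernel; congr (_ * _).
by apply: eq_bigr => i _; rewrite mul1r.
Qed.

Lemma mean_ksd_regression : has_integral (gaussian mu) ksd_regression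
  (Num.sqrt (g / (g + 2)) ^+ d * \sum_i mu ord0 i ^+ 2).
Proof.
have [||i|i y|i|i|i|_ H _] := @tilted_gaussian_centered
  (Num.sqrt (g / (g + 1))) (2 * (g + 1))^-1
  0 ((g + 1) / (g + 2)) (fun i => mu ord0 i) (fun i => mu ord0 i)
  (fun i => (g + 2) / (g + 1) * mu ord0 i) (fun i => mu ord0 i ^+ 2)
  (fun i => Num.sqrt (g / (g + 2)))
  (fun i => mu ord0 i ^+ 2)
  (fun i => (g + 1) / (g + 2) * ((g + 2) / (g + 1) * mu ord0 i) ^+ 2
     + 2 * 0 ^+ 2 * ((g + 1) / (g + 2)) ^+ 2)
  (fun i r => (g + 2) / (g + 1) * mu ord0 i * (r - mu ord0 i) + mu ord0 i ^+ 2).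
- by rewrite invr_ge0 ?mulr_ge0 ?addr_ge0 ?ltW.
- by field; rewrite !gn.
- by field; rewrite !gn.
- by rewrite mul0r add0r.
- rewrite subrr expr0n/= mulr0 oppr0 expR0 mulr1 -sqrtrM.
    by rewrite mulrA divfK.
  by rewrite divr_ge0 ?addr_ge0 ?ltW.
- by rewrite mul0r add0r.
- by [].
by move: H; rewrite prodr_const card_ord.
Qed.

Lemma mean_sqr_ksd_regression : has_integral (gaussian mu) (fun x => ksd_regression x ^+ 2)
  ((g / (g + 1) * Num.sqrt ((g + 1) / (g + 3))) ^+ d *
   ((\sum_i mu ord0 i ^+ 2) ^+ 2
    + (g + 2) ^+ 2 / ((g + 1) * (g + 3)) * \sum_i mu ord0 i ^+ 2)).
Proof.
have [||i|i y|i|i|i|_ _ H] := @tilted_gaussian_centered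
  (g / (g + 1)) (g + 1)^-1
  0 ((g + 1) / (g + 3)) (fun i => mu ord0 i) (fun i => mu ord0 i)
  (fun i => (g + 2) / (g + 1) * mu ord0 i) (fun i => mu ord0 i ^+ 2)
  (fun i => g / (g + 1) * Num.sqrt ((g + 1) / (g + 3)))
  (fun i => mu ord0 i ^+ 2)
  (fun i => (g + 2) ^+ 2 / ((g + 1) * (g + 3)) * mu ord0 i ^+ 2)
  (fun i r => (g + 2) / (g + 1) * mu ord0 i * (r - mu ord0 i) + mu ord0 i ^+ 2).
- by rewrite invr_ge0 ?mulr_ge0 ?addr_ge0 ?ltW.
- by field; rewrite !gn.
- by field; rewrite !gn.
- by rewrite mul0r add0r.
- by rewrite subrr expr0n/= mulr0 oppr0 expR0 mulr1.
- by rewrite mul0r add0r.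
- by field; rewrite !gn.
move: H; rewrite prodr_const card_ord -mulr_sumr; apply: eq_has_integral => x.
rewrite /ksd_regression exprMn; congr (_ * _).
rewrite -prodrXl; apply: eq_bigr => i _; rewrite exprMn sqr_sqrtr.
  set r := x ord0 i - _; rewrite -expRM_natl.
  by have -> : 2%:R * - ((2 * (g + 1))^-1 * r ^+ 2) = - ((g + 1)^-1 * r ^+ 2)
    by field; rewrite !gn.
by rewrite divr_ge0 ?addr_ge0 ?ltW.
Qed.

(** Mean square of the kernel for a fixed first point [x]: square of the mean
    plus variance under the reweighted law of the second point. Both sums are
    again sums of quadratics, now centred at [mu], the mean of the law that the
    weight in [x] induces. *)
Lemma ksd_cond_sqr x : has_integral (gaussian mu) (fun y => ksd_kernel g x y ^+ 2)
  ((\prod_i (Num.sqrt (g / (g + 2)) *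
     expR (- ((g + 2)^-1 * (x ord0 i - mu ord0 i) ^+ 2)))) *
   ((\sum_i ((g + 3) / (g + 2) ^+ 2 * (x ord0 i - mu ord0 i) ^+ 2
      + (g + 4) / (g + 2) * mu ord0 i * (x ord0 i - mu ord0 i)
      + (mu ord0 i ^+ 2 + (g * (g + 2))^-1))) ^+ 2 +
    \sum_i (g / (g + 2) * (mu ord0 i + (g ^+ 2 + 4 * g + 2) / (g * (g + 2))
        * (x ord0 i - mu ord0 i)) ^+ 2
      + 2 * (g + 1) ^+ 2 / (g ^+ 2 * (g + 2) ^+ 2)))).
Proof.
pose p i := (g * mu ord0 i + 2 * x ord0 i) / (g + 2).
pose be i := x ord0 i + 2 * ((g + 1) / g ^+ 2) * (x ord0 i - p i).
pose ka i := x ord0 i * p i - (g + 1) / g ^+ 2 * (p i - x ord0 i) ^+ 2 + g^-1.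
have [||i|i y|i|i|i|_ _ H] := @tilted_gaussian_centered 1 g^-1
  (- ((g + 1) / g ^+ 2)) (g / (g + 2)) (fun i => x ord0 i) p be ka
  (fun i => Num.sqrt (g / (g + 2)) *
     expR (- ((g + 2)^-1 * (x ord0 i - mu ord0 i) ^+ 2)))
  (fun i => (g + 3) / (g + 2) ^+ 2 * (x ord0 i - mu ord0 i) ^+ 2
      + (g + 4) / (g + 2) * mu ord0 i * (x ord0 i - mu ord0 i)
      + (mu ord0 i ^+ 2 + (g * (g + 2))^-1))
  (fun i => g / (g + 2) * (mu ord0 i + (g ^+ 2 + 4 * g + 2) / (g * (g + 2))
        * (x ord0 i - mu ord0 i)) ^+ 2
      + 2 * (g + 1) ^+ 2 / (g ^+ 2 * (g + 2) ^+ 2))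
  (fun i r => x ord0 i * r - (g + 1) / g ^+ 2 * (r - x ord0 i) ^+ 2 + g^-1).
- by rewrite invr_ge0 ?mulr_ge0 ?addr_ge0 ?ltW.
- by field; rewrite !gn.
- by rewrite /p; field; rewrite !gn.
- by rewrite /be /ka; ring.
- have -> : g^-1 * (g / (g + 2)) = (g + 2)^-1 by field; rewrite !gn.
  by rewrite mul1r.
- by rewrite /ka /p; field; rewrite !gn.
- by rewrite /be /p; field; rewrite !gn.
apply: eq_has_integral H => y; rewrite /ksd_kernel exprMn; congr (_ * _).
rewrite -prodrXl; apply: eq_bigr => i _; rewrite mul1r.
set r := y ord0 i - _; rewrite -expRM_natl.
by have -> : 2%:R * - ((2 * g)^-1 * r ^+ 2) = - (g^-1 * r ^+ 2)
  by field; rewrite !gn.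
Qed.

Lemma mean_sqr_ksd_kernel :
  (\int[gaussian mu]_x \int[gaussian mu]_y (ksd_kernel g x y ^+ 2)%:E =
   (Num.sqrt (g / (g + 4)) ^+ d *
    ((\sum_i mu ord0 i ^+ 2 + d%:R * ((g + 2) / (g * (g + 4)))) ^+ 2
     + 2 * \sum_i mu ord0 i ^+ 2
     + d%:R * (2^-1 + 2^-1 * (1 + 4 / (g * (g + 4))) ^+ 2)))%:E)%E.
Proof.
under eq_integral do rewrite (ksd_cond_sqr _).2.
have [||i|i y|i|i|i|_ _ H2] := @tilted_gaussian_centered
  (Num.sqrt (g / (g + 2))) (g + 2)^-1
  ((g + 3) / (g + 2) ^+ 2) ((g + 2) / (g + 4)) (fun i => mu ord0 i) (fun i => mu ord0 i)
  (fun i => (g + 4) / (g + 2) * mu ord0 i)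
  (fun i => mu ord0 i ^+ 2 + (g * (g + 2))^-1)
  (fun i => Num.sqrt (g / (g + 4)))
  (fun i => mu ord0 i ^+ 2 + (g + 2) / (g * (g + 4)))
  (fun i => (g + 4) / (g + 2) * mu ord0 i ^+ 2 +
     2 * (g + 3) ^+ 2 / ((g + 2) ^+ 2 * (g + 4) ^+ 2))
  (fun i r => (g + 3) / (g + 2) ^+ 2 * (r - mu ord0 i) ^+ 2
      + (g + 4) / (g + 2) * mu ord0 i * (r - mu ord0 i)
      + (mu ord0 i ^+ 2 + (g * (g + 2))^-1)).
- by rewrite invr_ge0 ?mulr_ge0 ?addr_ge0 ?ltW.
- by field; rewrite !gn.
- by field; rewrite !gn.
- by [].
- rewrite subrr expr0n/= mulr0 oppr0 expR0 mulr1 -sqrtrM.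
    by rewrite mulrA divfK.
  by rewrite divr_ge0 ?addr_ge0 ?ltW.
- by field; rewrite !gn.
- by field; rewrite !gn.
have [||i|i y|i|i|i|_ H1 _] := @tilted_gaussian_centered
  (Num.sqrt (g / (g + 2))) (g + 2)^-1
  (g / (g + 2) * ((g ^+ 2 + 4 * g + 2) / (g * (g + 2))) ^+ 2)
  ((g + 2) / (g + 4)) (fun i => mu ord0 i) (fun i => mu ord0 i)
  (fun i => 2 * mu ord0 i * ((g ^+ 2 + 4 * g + 2) / (g + 2) ^+ 2))
  (fun i => g / (g + 2) * mu ord0 i ^+ 2 + 2 * (g + 1) ^+ 2 / (g ^+ 2 * (g + 2) ^+ 2))
  (fun i => Num.sqrt (g / (g + 4)))
  (fun i => g / (g + 2) * mu ord0 i ^+ 2 +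
    (2 * (g + 1) ^+ 2 / (g ^+ 2 * (g + 2) ^+ 2) +
     (g ^+ 2 + 4 * g + 2) ^+ 2 / (g * (g + 2) ^+ 2 * (g + 4))))
  (fun i => (g + 2) / (g + 4) *
    (2 * mu ord0 i * ((g ^+ 2 + 4 * g + 2) / (g + 2) ^+ 2)) ^+ 2 +
    2 * (g / (g + 2) * ((g ^+ 2 + 4 * g + 2) / (g * (g + 2))) ^+ 2) ^+ 2 *
    ((g + 2) / (g + 4)) ^+ 2)
  (fun i r => g / (g + 2) * (mu ord0 i + (g ^+ 2 + 4 * g + 2) / (g * (g + 2))
        * (r - mu ord0 i)) ^+ 2
      + 2 * (g + 1) ^+ 2 / (g ^+ 2 * (g + 2) ^+ 2)).
- by rewrite invr_ge0 ?mulr_ge0 ?addr_ge0 ?ltW.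
- by field; rewrite !gn.
- by field; rewrite !gn.
- by field; rewrite !gn.
- rewrite subrr expr0n/= mulr0 oppr0 expR0 mulr1 -sqrtrM.
    by rewrite mulrA divfK.
  by rewrite divr_ge0 ?addr_ge0 ?ltW.
- by field; rewrite !gn.
- by [].
have [_ H] := has_integralD H2 H1.
under eq_integral do rewrite mulrDr.
rewrite H; congr (_%:E); rewrite prodr_const card_ord -mulrDr; congr (_ * _).
have SE (a k : R) : \sum_i (a * mu ord0 i ^+ 2 + k) =
    a * (\sum_i mu ord0 i ^+ 2) + d%:R * k.
  by rewrite big_split/= -mulr_sumr sumr_const card_ord (mulr_natl k).
have S1 (k : R) : \sum_i (mu ord0 i ^+ 2 + k) =
    \sum_i mu ord0 i ^+ 2 + d%:R * k.
  by rewrite big_split/= sumr_const card_ord (mulr_natl k).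
rewrite !SE S1; move: (\sum_i _) (d%:R) => M D.
by field; rewrite !gn.
Qed.

Lemma measurable_ksd_kernel :
  measurable_fun [set: 'rV[R]_d * 'rV[R]_d] (fun w => ksd_kernel g w.1 w.2).
Proof.
have mx i : measurable_fun [set: 'rV[R]_d * 'rV[R]_d] (fun w => w.1 ord0 i).
  exact: measurableT_comp (measurable_rV_coord i) measurable_fst.
have my i : measurable_fun [set: 'rV[R]_d * 'rV[R]_d] (fun w => w.2 ord0 i).
  exact: measurableT_comp (measurable_rV_coord i) measurable_snd.
have mxy i : measurable_fun [set: 'rV[R]_d * 'rV[R]_d]
    (fun w => (w.2 ord0 i - w.1 ord0 i) ^+ 2).
  by apply: measurable_funX; exact: measurable_funB.
apply: measurable_funM.
  apply: measurable_prod => i _; apply: measurableT_comp => //.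
  by apply: measurableT_comp => //; exact: measurable_funM.
apply: measurable_sum => i; apply: measurable_funD => //; apply: measurable_funB.
  exact: measurable_funM.
exact: measurable_funM.
Qed.

Lemma moment_ratio_ksd :
  moment_ratio (gaussian mu)
    (u_ksd (gaussian_pdf (0 : 'rV[R]_d)) (rbf g)) =
  Num.sqrt (Num.sqrt (g / (g + 4)) ^+ d *
    ((norm2 mu ^+ 2 + d%:R * ((g + 2) / (g * (g + 4)))) ^+ 2
     + 2 * norm2 mu ^+ 2
     + d%:R * (2^-1 + 2^-1 * (1 + 4 / (g * (g + 4))) ^+ 2))
    - (g / (g + 2)) ^+ d * norm2 mu ^+ 4) /
  Num.sqrt ((g / (g + 1) * Num.sqrt ((g + 1) / (g + 3))) ^+ d *
    (norm2 mu ^+ 4 + (g + 2) ^+ 2 / ((g + 1) * (g + 3)) * norm2 mu ^+ 2)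
    - (g / (g + 2)) ^+ d * norm2 mu ^+ 4).
Proof.
have -> : u_ksd (gaussian_pdf (0 : 'rV[R]_d)) (rbf g) = ksd_kernel g.
  by apply/funext => x; apply/funext => y; exact: u_ksdE.
have -> : norm2 mu ^+ 4 = (norm2 mu ^+ 2) ^+ 2 by rewrite -exprM.
have [h1 h2] := has_integral_iter measurable_ksd_kernel ksd_cond_mean mean_ksd_regression mean_sqr_ksd_kernel.
rewrite /moment_ratio (sigma_fullE h1 h2).
rewrite (sigma_condE h1.1 ksd_cond_mean mean_ksd_regression mean_sqr_ksd_regression).
rewrite (norm2_sqr mu) exprMn exprAC sqr_sqrtr//.
by rewrite divr_ge0 ?addr_ge0 ?ltW.
Qed.

End ksd_moments.

(** * Two-sided bounds for every bandwidth at least 2 *)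

Section power_bounds.
Context {R : realType}.
Implicit Types (x s g D M : R) (n : nat).

Lemma bernoulli_ge x n : 0 <= 1 + x -> 1 + n%:R * x <= (1 + x) ^+ n.
Proof.
move=> x1; elim: n => [|n IH]; first by rewrite mul0r addr0 expr0.
rewrite exprS (le_trans _ (ler_wpM2l x1 IH))// -natr1.
by have := mulr_ge0 (ler0n R n) (sqr_ge0 x); rewrite expr2; lra.
Qed.

(** Bernoulli's inequality from both sides: s lies between 1 - x and 1 - x / 2,
    and the latter is at most 1 / (1 + x / 2). *)
Lemma sqrt_pow_bounds s x n : 0 <= s -> 0 <= x -> s ^+ 2 = 1 - x ->
  1 - n%:R * x <= s ^+ n /\ s ^+ n * (1 + n%:R * (x / 2)) <= 1.
Proof.
move=> s0 x0 sx.
have x1 : 0 <= 1 - x by rewrite -sx sqr_ge0.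
have s1 : s <= 1 by rewrite -(@ler_pXn2r _ 2)// ?nnegrE// sx expr1n; lra.
have sh : s <= 1 - x / 2.
  have x2 : 0 <= 1 - x / 2 by lra.
  rewrite -(@ler_pXn2r _ 2)// ?nnegrE//.
  by rewrite sx; have := sqr_ge0 (x / 2); nra.
split.
  have := @bernoulli_ge (- x) n; rewrite mulrN => /(_ x1) /le_trans; apply.
  rewrite -sx lerXn2r ?nnegrE ?sqr_ge0//.
  by rewrite expr2 ler_piMl.
have h2 : 0 <= 1 + x / 2 by lra.
rewrite (@le_trans _ _ (s ^+ n * (1 + x / 2) ^+ n))//.
  apply: ler_wpM2l; first exact: exprn_ge0.
  exact: bernoulli_ge.
rewrite -exprMn exprn_ile1 ?mulr_ge0//.
rewrite (le_trans (ler_wpM2r h2 sh))//.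
by have := sqr_ge0 (x / 2); rewrite expr2; lra.
Qed.

(** With t = n / g^2, the power is between 1 - 4 t and 1 / (1 + t / 8), so its
    distance to 1 is of order t for small t and of order 1 for large t. *)
Lemma defect_bounds (g a : R) (s : R) n : 2 <= g -> 1 <= a <= 4 -> 0 <= s ->
  s ^+ 2 = 1 - a / (g + 2) ^+ 2 ->
  let tau := n%:R / (g ^+ 2 + n%:R) in
  0 <= 1 - s ^+ n /\ tau / 8 <= 1 - s ^+ n <= 8 * tau.
Proof.
move=> g2 /andP[a1 a4] s0 sE tau; pose D : R := n%:R.
have D0 : 0 <= D by exact: ler0n.
have gp : 0 < (g + 2) ^+ 2 by rewrite exprn_gt0//; lra.
have gg : 0 < g ^+ 2 by rewrite exprn_gt0//; lra.
have gD : 0 < g ^+ 2 + D by lra.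
pose x := a / (g + 2) ^+ 2.
have x0 : 0 <= x by rewrite divr_ge0//; lra.
have [L U] := @sqrt_pow_bounds s x n s0 x0 sE.
set P := s ^+ n in L U *.
have P0 : 0 <= P by exact: exprn_ge0.
have xu : x * g ^+ 2 <= 4.
  rewrite /x mulrAC ler_pdivrMr//.
  by have := mulr_ge0 (ltW gg) (_ : 0 <= 4 - a); rewrite !expr2; nra.
have xl : 1 <= x * (4 * g ^+ 2).
  rewrite /x mulrAC ler_pdivlMr// mul1r (@le_trans _ _ (4 * g ^+ 2))//.
    by rewrite !expr2; nra.
  by rewrite ler_peMl//; lra.
have P1 : P <= 1.
  by apply: le_trans U; rewrite ler_peMr// lerDl mulr_ge0//; lra.
have Up : P * (8 * g ^+ 2 + D) <= 8 * g ^+ 2.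
  have : P * (D * 1) <= P * (D * (x * (4 * g ^+ 2))) by rewrite !ler_wpM2l.
  have : P * (1 + D * (x / 2)) * (8 * g ^+ 2) <= 1 * (8 * g ^+ 2).
    by rewrite ler_wpM2r//; lra.
  lra.
have Lo : (1 - P) * g ^+ 2 <= 4 * D.
  have : D * (x * g ^+ 2) <= D * 4 by rewrite ler_wpM2l.
  have : (1 - P) * g ^+ 2 <= (D * x) * g ^+ 2 by rewrite ler_wpM2r//; lra.
  lra.
have PD : 0 <= P * D by exact: mulr_ge0.
have PD1 : 0 <= (1 - P) * D by rewrite mulr_ge0// subr_ge0.
have Pg : 0 <= (1 - P) * g ^+ 2 by rewrite mulr_ge0//; lra.
split; first lra.
rewrite /tau -/D; apply/andP; split.
  rewrite mulrAC ler_pdivrMr//. lra.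
by rewrite mulrA ler_pdivlMr//; lra.
Qed.

End power_bounds.

Section two_sided_bound.
Context {R : realType}.
Implicit Types (g D M : R) (d : nat).

(** t / (1 + t) for t = D / g^2. *)
Definition damping g D : R := D / (g ^+ 2 + D).

(** The squared moment ratio up to constants and up to the exponential factor;
    [M] stands for the squared norm of the mean. *)
Definition rate g D M : R :=
  (damping g D * M ^+ 2 + M * (D / g) + (D / g) ^+ 2 + M + D) /
  (damping g D * M ^+ 2 + M).

(** The logarithm of (G / A)^(1/2), where G and A are the prefactors of the mean
    squares of the kernel and of its conditional expectation. *)
Definition log_factor g D : R := D / 4 * ln (1 + 3 / (g * (g + 4))).

(** The numerator and the denominator are compared term by term with those of
    [F], each within a factor 8. *)
Lemma quotient_bounds (tau q p h k D et c M : R) :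
  0 <= tau -> 0 <= h -> 0 <= D -> 0 < M -> 1 <= et <= 2 -> 1 <= c <= 2 ->
  tau / 8 <= 1 - q <= 8 * tau -> tau / 8 <= 1 - p <= 8 * tau ->
  h / 2 <= k <= h ->
  let N := (1 - q) * M ^+ 2 + 2 * (M * k) + k ^+ 2 + 2 * M + D * et in
  let C := (1 - p) * M ^+ 2 + c * M in
  let F := (tau * M ^+ 2 + M * h + h ^+ 2 + M + D) / (tau * M ^+ 2 + M) in
  [/\ 0 <= N, 0 < C & F / 64 <= N / C <= 64 * F].
Proof.
move=> tau0 h0 D0 M0 /andP[el eu] /andP[cl cu] /andP[ql qu] /andP[pl pu].
move=> /andP[kl ku]; cbv zeta.
set N := _ + D * et; set C := _ + c * M.
set F0 := _ + D; set C0 := tau * M ^+ 2 + M.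
have MM0 : 0 <= M ^+ 2 := sqr_ge0 M.
have Dl : D <= D * et by rewrite ler_peMr.
have Du : D * et <= D * 2 by rewrite ler_wpM2l.
have cMl : M <= c * M by rewrite ler_peMl// ltW.
have cMu : c * M <= 2 * M by rewrite ler_wpM2r// ltW.
have ql' : tau / 8 * M ^+ 2 <= (1 - q) * M ^+ 2 by rewrite ler_wpM2r.
have qu' : (1 - q) * M ^+ 2 <= 8 * tau * M ^+ 2 by rewrite ler_wpM2r.
have pl' : tau / 8 * M ^+ 2 <= (1 - p) * M ^+ 2 by rewrite ler_wpM2r.
have pu' : (1 - p) * M ^+ 2 <= 8 * tau * M ^+ 2 by rewrite ler_wpM2r.
have tM : 0 <= tau * M ^+ 2 by rewrite mulr_ge0.
have hl : M * (h / 2) <= M * k by rewrite ler_wpM2l// ltW.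
have hu : M * k <= M * h by rewrite ler_wpM2l// ltW.
have hM : 0 <= M * h by rewrite mulr_ge0// ltW.
have hh : 0 <= h ^+ 2 := sqr_ge0 h.
have h20 : 0 <= h / 2 by rewrite divr_ge0.
have k0 : 0 <= k := le_trans h20 kl.
have kkl : (h / 2) ^+ 2 <= k ^+ 2 by rewrite lerXn2r ?nnegrE.
have kku : k ^+ 2 <= h ^+ 2 by rewrite lerXn2r ?nnegrE.
clear kl ku ql qu pl pu cl cu el eu.
have NF : F0 / 8 <= N by rewrite /N /F0; lra.
have FN : N <= 8 * F0 by rewrite /N /F0; lra.
have CC : C0 / 8 <= C by rewrite /C /C0; lra.
have Cu : C <= 8 * C0 by rewrite /C /C0; lra.
have F00 : 0 <= F0 by rewrite /F0; lra.
have C00 : 0 < C0 by rewrite /C0; lra.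
clearbody N C F0 C0; clear -NF FN CC Cu F00 C00.
have Cp : 0 < C by lra.
have Fq : 0 <= F0 / C0 by rewrite divr_ge0// ltW.
have FE : F0 / C0 * C0 = F0 by rewrite divfK// gt_eqF.
split => //; first lra; apply/andP; split.
  rewrite ler_pdivlMr//; have := ler_wpM2l Fq Cu; lra.
rewrite ler_pdivrMr//; have := ler_wpM2l Fq CC; lra.
Qed.

(** The squared mean, common to both variances, is written as a multiple [q] of
    the prefactor of the numerator and a multiple [p] of the prefactor of the
    denominator; [defect_bounds] controls 1 - q and 1 - p. *)
Lemma moment_quotient_bounds g M d : 2 <= g -> 0 < M ->
  let V := Num.sqrt (g / (g + 4)) ^+ d *
    ((M + d%:R * ((g + 2) / (g * (g + 4)))) ^+ 2 + 2 * M
     + d%:R * (2^-1 + 2^-1 * (1 + 4 / (g * (g + 4))) ^+ 2))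
    - (g / (g + 2)) ^+ d * M ^+ 2 in
  let C := (g / (g + 1) * Num.sqrt ((g + 1) / (g + 3))) ^+ d *
    (M ^+ 2 + (g + 2) ^+ 2 / ((g + 1) * (g + 3)) * M)
    - (g / (g + 2)) ^+ d * M ^+ 2 in
  let K := expR (2 * log_factor g d%:R) * rate g d%:R M in
  [/\ 0 <= V, 0 <= C & K / 64 <= V / C <= 64 * K].
Proof.
move=> g2 M0; set a := Num.sqrt _; set b := _ / (g + 1) * _; set e := g / (g + 2).
set D : R := d%:R; set de := (g + 2) / _; set et := 2^-1 + _; set c := _ / (_ * _).
cbv zeta.
have D0 : 0 <= D by exact: ler0n.
have gp : 0 < g by lra.
have g1 : 0 < g + 1 by lra.
have g2' : 0 < g + 2 by lra.
have g3 : 0 < g + 3 by lra.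
have g4 : 0 < g + 4 by lra.
have n0 : g != 0 by rewrite gt_eqF.
have n1 : g + 1 != 0 by rewrite gt_eqF.
have n2 : g + 2 != 0 by rewrite gt_eqF.
have n3 : g + 3 != 0 by rewrite gt_eqF.
have n4 : g + 4 != 0 by rewrite gt_eqF.
have a0 : 0 < a by rewrite sqrtr_gt0 divr_gt0.
have b0 : 0 < b by rewrite mulr_gt0 ?sqrtr_gt0 ?divr_gt0.
have e0 : 0 < e by rewrite divr_gt0.
have an0 : a != 0 by rewrite gt_eqF.
have bn0 : b != 0 by rewrite gt_eqF.
have a2 : a ^+ 2 = g / (g + 4) by rewrite sqr_sqrtr// ltW// divr_gt0.
have b2 : b ^+ 2 = g ^+ 2 / ((g + 1) * (g + 3)).
  rewrite exprMn sqr_sqrtr; last by rewrite ltW// divr_gt0.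
  by field; rewrite n1 n3.
have [q0 /andP[ql qu]] := @defect_bounds R g 4 (e / a) d g2
  (ltac:(lra)) (ltac:(by rewrite ltW// divr_gt0))
  (ltac:(by rewrite expr_div_n a2 /e; field; rewrite n0 n2 n4)).
have [p0 /andP[pl pu]] := @defect_bounds R g 1 (e / b) d g2
  (ltac:(lra)) (ltac:(by rewrite ltW// divr_gt0))
  (ltac:(by rewrite expr_div_n b2 /e; field; rewrite n0 n1 n2 n3)).
set q := (e / a) ^+ d in q0 ql qu; set p := (e / b) ^+ d in p0 pl pu.
have eq_ : e ^+ d = a ^+ d * q by rewrite /q -exprMn mulrC divfK.
have ep_ : e ^+ d = b ^+ d * p by rewrite /p -exprMn mulrC divfK.
have ab : a ^+ d = b ^+ d * expR (2 * log_factor g D).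
  have y0 : 0 < 1 + 3 / (g * (g + 4)) by rewrite addr_gt0 ?divr_gt0 ?mulr_gt0.
  have -> : 2 * log_factor g D = d%:R * (2^-1 * ln (1 + 3 / (g * (g + 4)))).
    by rewrite /log_factor -/D; field.
  rewrite expRM_natl -exprMn; congr (_ ^+ _).
  have z0 := mulr_ge0 (ltW b0) (expR_ge0 (2^-1 * ln (1 + 3 / (g * (g + 4))))).
  apply/eqP; rewrite -(@eqrXn2 _ 2 _ _ isT (ltW a0) z0).
  rewrite exprMn a2 b2 -expRM_natl mulrA divff// mul1r lnK//.
  by apply/eqP; field; rewrite n0 n1 n3 n4.
have ad0 : 0 < a ^+ d by rewrite exprn_gt0.
have bd0 : 0 < b ^+ d by rewrite exprn_gt0.
move: ab; set W := expR (2 * log_factor g D) => ab; have W0 : 0 < W := expR_gt0 _.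
pose tau := damping g D.
have tau0 : 0 <= tau by rewrite divr_ge0// addr_ge0// sqr_ge0.
rewrite -/(damping g D) -/tau in ql qu pl pu.
have gi0 : 0 <= g^-1 by rewrite invr_ge0 ltW.
have deE : de = (g + 2) / (g + 4) / g by rewrite /de; field; rewrite n0 n4.
have del : (D / g) / 2 <= D * de.
  rewrite -mulrA ler_wpM2l// deE mulrC ler_wpM2r //.
  by rewrite ler_pdivlMr//; lra.
have deu : D * de <= D / g.
  rewrite ler_wpM2l// deE -[leRHS]mul1r ler_wpM2r //.
  by rewrite ler_pdivrMr//; lra.
have etl : 1 <= et.
  rewrite /et; have : 0 <= 4 / (g * (g + 4)) by rewrite divr_ge0// ltW// mulr_gt0.
  move: (4 / _) => z z0; nra.
have etu : et <= 2.
  have : 4 / (g * (g + 4)) <= 2^-1.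
    rewrite ler_pdivrMr ?mulr_gt0//; nra.
  have : 0 <= 4 / (g * (g + 4)) by rewrite divr_ge0// ltW// mulr_gt0.
  rewrite /et; move: (4 / _) => z z0 z1; nra.
have cl : 1 <= c.
  by rewrite /c ler_pdivlMr ?mulr_gt0//; nra.
have cu : c <= 2.
  by rewrite /c ler_pdivrMr ?mulr_gt0//; nra.
have etlu : 1 <= et <= 2 by rewrite etl etu.
have clu : 1 <= c <= 2 by rewrite cl cu.
have qlu : tau / 8 <= 1 - q <= 8 * tau by rewrite ql qu.
have plu : tau / 8 <= 1 - p <= 8 * tau by rewrite pl pu.
have klu : D / g / 2 <= D * de <= D / g by rewrite del deu.
have [N0 C0 FNC] := quotient_bounds tau0 (divr_ge0 D0 (ltW gp)) D0 M0 etlu clu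
  qlu plu klu.
rewrite {1 3 5}eq_ ep_ ab.
move: (b ^+ d) bd0 => Bd bd0.
have -> : Bd * W * ((M + D * de) ^+ 2 + 2 * M + D * et) - Bd * W * q * M ^+ 2 =
  Bd * (W * ((1 - q) * M ^+ 2 + 2 * (M * (D * de)) + (D * de) ^+ 2 + 2 * M + D * et)) by ring.
have -> : Bd * (M ^+ 2 + c * M) - Bd * p * M ^+ 2 =
  Bd * ((1 - p) * M ^+ 2 + c * M) by ring.
move: N0 C0 FNC; rewrite -/(rate g D M).
set N := _ + D * et; set C := _ + c * M; move: (rate g D M) => F N0 C0 FNC.
split; [by rewrite !mulr_ge0// ltW|by rewrite mulr_ge0// ltW|].
have -> : Bd * (W * N) / (Bd * C) = W * (N / C) by field; rewrite !gt_eqF.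
have /andP[F1 F2] := FNC.
have Wge0 := ltW W0; apply/andP; split.
  by rewrite -(mulrA W F); exact: (ler_wpM2l Wge0 F1).
by rewrite (mulrCA 64 W); exact: (ler_wpM2l Wge0 F2).
Qed.

End two_sided_bound.

(** * The three regimes *)

Section regimes.
Context {R : realType}.
Implicit Types (g D M m s : R).

Lemma log_factor_bounds g D : 0 < g -> 0 <= D ->
  0 <= log_factor g D <= 3 / 4 * (D / g ^+ 2).
Proof.
move=> g0 D0; rewrite /log_factor; set y := 3 / _.
have y0 : 0 < y by rewrite divr_gt0// mulr_gt0// addr_gt0.
have yg : y <= 3 / g ^+ 2.
  rewrite ler_pM2l// lef_pV2 ?posrE ?mulr_gt0 ?addr_gt0 ?exprn_gt0//.
  by rewrite expr2 ler_pM2l// lerDl.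
apply/andP; split; first by rewrite mulr_ge0 ?divr_ge0// ln_ge0// lerDl ltW.
have lny : ln (1 + y) <= y.
  by rewrite -[leRHS]expRK ler_ln ?posrE ?expR_gt0 ?addr_gt0// expR_ge1Dx.
have -> : 3 / 4 * (D / g ^+ 2) = D / 4 * (3 / g ^+ 2) by ring.
by rewrite ler_wpM2l ?divr_ge0// (le_trans lny).
Qed.

Lemma log_factor_approx g D : 0 < g -> 0 <= D ->
  `|log_factor g D - 3 * D / (4 * g ^+ 2)| <= 3 / g * (D / g ^+ 2).
Proof.
move=> g0 D0; have /andP[_ U] := log_factor_bounds g0 D0.
have gn : g != 0 by rewrite gt_eqF.
have g4 : 0 < g + 4 by rewrite addr_gt0.
have gi : 0 < g^-1 by rewrite invr_gt0.
have D2 : 0 <= D / g ^+ 2 by rewrite divr_ge0// sqr_ge0.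
have E0 : 0 <= 3 / g * (D / g ^+ 2) by rewrite mulr_ge0// mulr_ge0// ltW.
have -> : 3 * D / (4 * g ^+ 2) = 3 / 4 * (D / g ^+ 2) by field.
rewrite ler_norml; apply/andP; split; last by move: U E0; lra.
rewrite /log_factor; set y := 3 / (g * (g + 4)).
have y0 : 0 < y by rewrite divr_gt0// mulr_gt0.
have y1 : 0 < 1 + y by rewrite addr_gt0.
have q0 : 0 < g ^+ 2 + 4 * g + 3 by rewrite !addr_gt0// ?exprn_gt0// mulr_gt0.
have wE : 1 - y / (1 + y) = (1 + y)^-1 by field; rewrite gt_eqF.
have yE : y / (1 + y) = 3 / (g ^+ 2 + 4 * g + 3).
  have n1 : 1 + y != 0 by rewrite gt_eqF.
  have nq : g ^+ 2 + 4 * g + 3 != 0 by rewrite gt_eqF.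
  apply/eqP; rewrite eqr_div//; apply/eqP; rewrite /y; field.
  by rewrite gn gt_eqF.
(* exp (- w) >= 1 - w for w = y / (1 + y), for which 1 - w = 1 / (1 + y). *)
have lo : y / (1 + y) <= ln (1 + y).
  have A : (1 + y)^-1 <= expR (- (y / (1 + y))).
    by have := expR_ge1Dx (- (y / (1 + y))); rewrite wE.
  rewrite -[leLHS]expRK ler_ln ?posrE ?expR_gt0//.
  by move: A; rewrite expRN lef_pV2 ?posrE ?expR_gt0.
have h : 3 / g ^+ 2 - 12 / (g * g ^+ 2) <= 3 / (g ^+ 2 + 4 * g + 3).
  rewrite ler_pdivlMr//.
  have -> : (3 / g ^+ 2 - 12 / (g * g ^+ 2)) * (g ^+ 2 + 4 * g + 3) =
    3 - (39 * g + 36) / (g * g ^+ 2) by field.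
  rewrite lerBlDr lerDl divr_ge0//.
    by rewrite addr_ge0// mulr_ge0// ltW.
  by rewrite mulr_ge0 ?sqr_ge0// ltW.
have := ler_wpM2l D0 (le_trans h (eq_ind _ (fun z => z <= _) lo _ yE)).
have -> : D * (3 / g ^+ 2 - 12 / (g * g ^+ 2)) =
  3 * (D / g ^+ 2) - 4 * (3 / g * (D / g ^+ 2)) by field.
lra.
Qed.

(** When [damping] is bounded below, the rate is of order 1 + a^2, where a M has
    the order of the larger of D / g and the square root of D; the term [b] is the geometric
    mean of [a] and 1, so it is harmless. *)
Lemma rate_small_bandwidth g D M a b k K : 0 < k <= 1 -> 1 <= K -> k <= M ->
  0 < g -> 0 <= D -> k <= damping g D -> 0 <= a -> 0 <= b -> b ^+ 2 = a ->
  (a * M) ^+ 2 <= (D / g) ^+ 2 + D <= K * (a * M) ^+ 2 ->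
  k ^+ 2 / 16 * (a + b + 1) ^+ 2 <= rate g D M <= 3 * K / k ^+ 2 * (a + b + 1) ^+ 2.
Proof.
move=> /andP[k0 k1] K1 kM g0 D0 kt a0 b0 ba.
have h0 : 0 <= D / g by rewrite divr_ge0// ltW.
rewrite /rate; set t := damping g D in kt *.
have t1 : t <= 1.
  rewrite /t /damping ler_pdivrMr ?mul1r ?lerDr ?sqr_ge0//.
  by rewrite ltr_pwDl// exprn_gt0.
move: (D / g) h0 => h h0 /andP[El Eu].
have M0 : 0 < M by exact: lt_le_trans kM.
set T := a + b + 1.
have T1 : T ^+ 2 <= 8 * (1 + a ^+ 2).
  have bl : b <= a + 1 by have := sqr_ge0 (b - 1); nra.
  have Tl : T <= 2 * (a + 1) by rewrite /T; lra.
  have Tp : 0 <= T by rewrite /T; lra.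
  rewrite (@le_trans _ _ ((2 * (a + 1)) ^+ 2))//.
    by rewrite lerXn2r// nnegrE; lra.
  by have := sqr_ge0 (a - 1); rewrite !expr2; lra.
have T2 : 1 + a ^+ 2 <= T ^+ 2.
  by rewrite /T; have := mulr_ge0 a0 b0; have := sqr_ge0 b; rewrite !expr2; nra.
have MM : 0 < M ^+ 2 by rewrite exprn_gt0.
have kMM : k * M <= M ^+ 2 by rewrite expr2 ler_wpM2r// ltW.
have tl : k * M ^+ 2 <= t * M ^+ 2 by rewrite ler_wpM2r// ltW.
have tu : t * M ^+ 2 <= M ^+ 2 by rewrite ler_piMl// ltW.
have kMp : 0 < k * M ^+ 2 by exact: mulr_gt0.
have C0 : 0 < t * M ^+ 2 + M by lra.
have aM : (a * M) ^+ 2 = a ^+ 2 * M ^+ 2 by rewrite exprMn.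
rewrite aM in El Eu.
have aa : 0 <= a ^+ 2 := sqr_ge0 a.
have aMM : 0 <= a ^+ 2 * M ^+ 2 by rewrite mulr_ge0// ltW.
have Mh : M * h <= (M ^+ 2 + h ^+ 2) / 2.
  by have := sqr_ge0 (M - h); rewrite !expr2; lra.
have Mh0 : 0 <= M * h by rewrite mulr_ge0// ltW.
have hh : 0 <= h ^+ 2 := sqr_ge0 h.
set N := _ + D; set C := _ + M in C0 *.
have Nl : k * (M ^+ 2 * (1 + a ^+ 2)) <= N.
  have : k * (a ^+ 2 * M ^+ 2) <= a ^+ 2 * M ^+ 2 by rewrite ler_piMl.
  by rewrite /N; lra.
have Cu : k * C <= 2 * M ^+ 2.
  have : k * (t * M ^+ 2) <= t * M ^+ 2 by rewrite ler_piMl// ltW// (lt_le_trans kMp).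
  by rewrite /C; lra.
have Cl : k * M ^+ 2 <= C by rewrite /C; lra.
have Nu : k * N <= 3 * K * (M ^+ 2 * (1 + a ^+ 2)).
  have : k * (t * M ^+ 2 + M * h + h ^+ 2 + D) <= t * M ^+ 2 + M * h + h ^+ 2 + D.
    by rewrite ler_piMl//; lra.
  have : M ^+ 2 <= K * M ^+ 2 by rewrite ler_peMl// ltW.
  by rewrite /N; lra.
clearbody N C T; apply/andP; split.
  rewrite ler_pdivlMr//.
  have : k ^+ 2 / 16 * T ^+ 2 * C <= k ^+ 2 / 16 * (8 * (1 + a ^+ 2)) * C.
    have k16 : 0 <= k ^+ 2 / 16 by rewrite divr_ge0// sqr_ge0.
    exact: ler_wpM2r (ltW C0) _ _ (ler_wpM2l k16 T1).
  have a1 : 0 <= 1 + a ^+ 2 by lra.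
  have ka : 0 <= k * (1 + a ^+ 2) / 2 by rewrite divr_ge0// mulr_ge0// ltW.
  have := ler_wpM2l ka Cu; rewrite !expr2 in Nl *; lra.
rewrite ler_pdivrMr//.
have kk : 0 < k ^+ 2 by rewrite exprn_gt0.
have -> : 3 * K / k ^+ 2 * T ^+ 2 * C = (3 * K * T ^+ 2 * C) / k ^+ 2 by ring.
rewrite ler_pdivlMr//.
have K0 : 0 <= K by lra.
have : 3 * K * (1 + a ^+ 2) * C <= 3 * K * T ^+ 2 * C.
  have K3 : 0 <= 3 * K by rewrite mulr_ge0.
  exact: ler_wpM2r (ltW C0) _ _ (ler_wpM2l K3 T2).
have X : 0 <= 3 * K * (1 + a ^+ 2) by rewrite !mulr_ge0//; lra.
have := ler_wpM2l X Cl; have := ler_wpM2l (ltW k0) Nu.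
rewrite !expr2; lra.
Qed.

(** Here s^2 is the dimension and s <= g. With X = s m / g, the denominator is
    of order m^2 (1 + X^2) and the numerator is of order
    m^2 (1 + X^2) + s^2. The summand s m / g^(1/2) in [T] is the geometric mean of [s] and
    m X. *)
Lemma rate_large_bandwidth g s m T : 0 < g -> 0 <= s -> s <= g -> 0 < m ->
  T = s * (1 + (Num.sqrt g)^-1 * m) / (m * (1 + g^-1 * s * m)) + 1 ->
  T ^+ 2 / 9 <= rate g (s ^+ 2) (m ^+ 2) <= 12 * T ^+ 2.
Proof.
move=> g0 s0 sg m0 TE0; pose w := Num.sqrt g.
have w0 : 0 < w by rewrite sqrtr_gt0.
have w2 : w ^+ 2 = g by rewrite sqr_sqrtr// ltW.
pose X := g^-1 * s * m; pose z := s * m / w.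
have X0 : 0 <= X by rewrite /X !mulr_ge0// ?invr_ge0 ltW.
have z0 : 0 <= z by rewrite /z divr_ge0 ?mulr_ge0// ltW.
have gn : g != 0 by rewrite gt_eqF.
have wn : w != 0 by rewrite gt_eqF.
have zz : z ^+ 2 = s * (m * X) by rewrite /z /X -w2; field.
have mX0 : 0 <= m * X by rewrite mulr_ge0// ltW.
have zle : z <= (s + m * X) / 2.
  rewrite -(@ler_pXn2r _ 2)// ?nnegrE; last by rewrite divr_ge0// addr_ge0.
  by rewrite zz; have := sqr_ge0 (s - m * X); rewrite !expr2; lra.
set Q := m * (1 + X); have Q0 : 0 < Q by rewrite mulr_gt0//; lra.
have TE : T = (s + z) / Q + 1 by rewrite TE0 -/w -/X -/Q /z; congr (_ / _ + 1); ring.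
set P := m ^+ 2 * (1 + X ^+ 2).
have P0 : 0 < P by rewrite mulr_gt0 ?exprn_gt0// ltr_pwDl// sqr_ge0.
have QP : P <= Q ^+ 2 <= 2 * P.
  rewrite /P /Q (exprMn 2 m) (mulrCA 2); apply/andP; split;
    apply: (ler_wpM2l (sqr_ge0 m)).
    by rewrite !expr2; lra.
  by have := sqr_ge0 (X - 1); rewrite !expr2; lra.
have X2 : m ^+ 2 * X ^+ 2 = m ^+ 2 * (m ^+ 2 * s ^+ 2 / g ^+ 2).
  by rewrite /X; field.
pose t := damping g (s ^+ 2).
have gg : 0 < g ^+ 2 by rewrite exprn_gt0.
have ss : 0 <= s ^+ 2 := sqr_ge0 s.
have sgg : s ^+ 2 <= g ^+ 2 by rewrite lerXn2r ?nnegrE// ltW.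
have gs0 : 0 < g ^+ 2 + s ^+ 2 by exact: ltr_wpDr.
have i1 : (g ^+ 2)^-1 / 2 <= (g ^+ 2 + s ^+ 2)^-1.
  rewrite -invfM lef_pV2 ?posrE//; last exact: mulr_gt0.
  by move: sgg; lra.
have i2 : (g ^+ 2 + s ^+ 2)^-1 <= (g ^+ 2)^-1.
  by rewrite lef_pV2 ?posrE// lerDl.
have tb : s ^+ 2 / g ^+ 2 / 2 <= t <= s ^+ 2 / g ^+ 2.
  by rewrite /t /damping -mulrA; apply/andP; split; exact: (ler_wpM2l ss).
have M4 : 0 <= (m ^+ 2) ^+ 2 := sqr_ge0 _.
have /andP[tl tu] : m ^+ 2 * X ^+ 2 / 2 <= t * (m ^+ 2) ^+ 2 <= m ^+ 2 * X ^+ 2.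
  have /andP[t1 t2] := tb; apply/andP; split.
    by have := ler_wpM2r M4 t1; rewrite X2; lra.
  by have := ler_wpM2r M4 t2; rewrite X2; lra.
have Mh : m ^+ 2 * (s ^+ 2 / g) <= (s ^+ 2 + m ^+ 2 * X ^+ 2) / 2.
  have -> : m ^+ 2 * (s ^+ 2 / g) = s * (m * X) by rewrite /X; field.
  by have := sqr_ge0 (s - m * X); rewrite !expr2; lra.
have Mh0 : 0 <= m ^+ 2 * (s ^+ 2 / g).
  by rewrite mulr_ge0 ?sqr_ge0// divr_ge0// ltW.
have hh : (s ^+ 2 / g) ^+ 2 <= s ^+ 2.
  have -> : (s ^+ 2 / g) ^+ 2 = s ^+ 2 * (s ^+ 2 / g ^+ 2) by field.
  by rewrite ler_piMr// ler_pdivrMr// mul1r.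
have hh0 : 0 <= (s ^+ 2 / g) ^+ 2 := sqr_ge0 _.
have m2 : 0 < m ^+ 2 by rewrite exprn_gt0.
have mX2 : 0 <= m ^+ 2 * X ^+ 2 by rewrite mulr_ge0 ?sqr_ge0// ltW.
have PE : P = m ^+ 2 * X ^+ 2 + m ^+ 2 by rewrite /P; ring.
rewrite /rate -/t; set N := _ + s ^+ 2; set C := _ + m ^+ 2.
have Nl : (P + s ^+ 2) / 2 <= N by rewrite /N PE; lra.
have Nu : N <= 3 * (P + s ^+ 2) by rewrite /N PE; lra.
have Cl : P / 2 <= C by rewrite /C PE; lra.
have Cu : C <= P by rewrite /C PE; lra.
have C0 : 0 < C by lra.
have /andP[QPl QPu] := QP.
have QQ0 : 0 < Q ^+ 2 by rewrite exprn_gt0.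
pose r := s / Q; have r0 : 0 <= r by rewrite /r divr_ge0// ltW.
have rP : r ^+ 2 * P <= s ^+ 2 <= 2 * (r ^+ 2 * P).
  have E : r ^+ 2 * Q ^+ 2 = s ^+ 2 by rewrite -exprMn divfK// gt_eqF.
  have rr : 0 <= r ^+ 2 := sqr_ge0 r.
  by have := ler_wpM2l rr QPl; have := ler_wpM2l rr QPu; rewrite E; lra.
have /andP[rPl rPu] := rP.
have Tl : r + 1 <= T.
  by rewrite TE lerD2r ler_wpM2r ?invr_ge0 ?(ltW Q0)// lerDl.
have mXQ : m * X / Q <= 1.
  by rewrite ler_pdivrMr// mul1r /Q mulrDr mulr1 lerDr ltW.
have Tu : T <= 3 / 2 * (r + 1).
  have : (s + z) / Q <= (s + (s + m * X) / 2) / Q.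
    by rewrite ler_wpM2r ?invr_ge0 ?(ltW Q0)// lerD2l.
  by rewrite TE /r; move: mXQ; rewrite !mulrDl; lra.
have T2l : 1 + r ^+ 2 <= T ^+ 2.
  rewrite (@le_trans _ _ ((r + 1) ^+ 2))//; first by rewrite !expr2; lra.
  by rewrite lerXn2r// nnegrE; lra.
have T2u : T ^+ 2 <= 9 / 2 * (1 + r ^+ 2).
  rewrite (@le_trans _ _ ((3 / 2 * (r + 1)) ^+ 2))//.
    by rewrite lerXn2r// nnegrE; lra.
  by have := sqr_ge0 (r - 1); rewrite !expr2; lra.
clear TE TE0; clearbody N C P r; clear -Nl Nu Cl Cu C0 rPl rPu T2l T2u P0.
apply/andP; split.
  rewrite ler_pdivlMr//.
  have T9 : 0 <= T ^+ 2 / 9 by rewrite divr_ge0// sqr_ge0.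
  have := ler_wpM2l T9 Cu; have := ler_wpM2r (ltW P0) T2u; lra.
rewrite ler_pdivrMr//.
have T9 : 0 <= 12 * T ^+ 2 by rewrite mulr_ge0// sqr_ge0.
have := ler_wpM2l T9 Cl; have := ler_wpM2r (ltW P0) T2l; lra.
Qed.

End regimes.

Section asymptotics.
Context {R : realType}.

Lemma littleo_near (f : nat -> R) (h : nat -> R) (e : R) : 0 < e ->
  f =o_\oo h -> \forall n \near \oo, `|f n| <= e * `|h n|.
Proof. by move=> e0 /eqoP; apply. Qed.

Lemma bigOmega_near (f h : nat -> R) : f =Omega_\oo h ->
  exists2 k : R, 0 < k & \forall n \near \oo, k * `|h n| <= `|f n|.
Proof. by rewrite eqOmegaE qualifE => /asboolP. Qed.

Lemma bigTheta_near (f h : nat -> R) : f =Theta_\oo h ->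
  exists k : R * R, [/\ 0 < k.1, 0 < k.2 &
   \forall n \near \oo, k.1 * `|h n| <= `|f n| <= k.2 * `|h n|].
Proof.
rewrite eqThetaE qualifE => /asboolP[k /andP[k1 k2] H]; exists k; split => //.
by apply: filterS H => n [-> ->].
Qed.

(** The moment ratio is a quotient of square roots, so it is compared through
    its square. *)
Lemma bigTheta_sqr (f h : nat -> R) (c1 c2 : R) : 0 < c1 -> 0 < c2 ->
  (\forall n \near \oo, [/\ 0 <= f n, 0 <= h n &
     c1 * h n ^+ 2 <= f n ^+ 2 <= c2 * h n ^+ 2]) -> f =Theta_\oo h.
Proof.
move=> c10 c20 H; rewrite eqThetaE qualifE; apply/asboolP.
exists (Num.sqrt c1, Num.sqrt c2) => /=; first by rewrite !sqrtr_gt0 c10.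
apply: filterS H => n [f0 h0 /andP[A B]]; rewrite !ger0_norm//; split.
  rewrite -(@ler_pXn2r _ 2)// ?nnegrE ?mulr_ge0 ?sqrtr_ge0//.
  by rewrite exprMn sqr_sqrtr// ltW.
rewrite -(@ler_pXn2r _ 2)// ?nnegrE ?mulr_ge0 ?sqrtr_ge0//.
by rewrite exprMn sqr_sqrtr// ltW.
Qed.

Lemma moment_ratio_bounds (d : nat) (g : R) (mu : 'rV[R]_d) :
  2 <= g -> 0 < norm2 mu ->
  let rho := moment_ratio (gaussian mu)
    (u_ksd (gaussian_pdf (0 : 'rV[R]_d)) (rbf g)) in
  let K := expR (2 * log_factor g d%:R) * rate g d%:R (norm2 mu ^+ 2) in
  0 <= rho /\ K / 64 <= rho ^+ 2 <= 64 * K.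
Proof.
move=> g2 m0; cbv zeta; rewrite moment_ratio_ksd; last by apply: lt_le_trans g2.
have M0 : 0 < norm2 mu ^+ 2 by rewrite exprn_gt0.
have [] := moment_quotient_bounds d g2 M0.
have -> : norm2 mu ^+ 4 = (norm2 mu ^+ 2) ^+ 2 by rewrite -exprM.
move=> V0 C0 VC; split; first by rewrite divr_ge0 ?sqrtr_ge0.
by rewrite expr_div_n (sqr_sqrtr V0) (sqr_sqrtr C0).
Qed.

End asymptotics.

(** Where the exponential factor [W] stays bounded, it is absorbed by the
    constants. *)
Lemma absorb_bounded_factor {R : realType} (W w F r2 t2 c1 c2 : R) :
  W * F / 64 <= r2 -> r2 <= 64 * (W * F) ->
  c1 * t2 <= F -> F <= c2 * t2 -> 1 <= W <= w -> 0 <= c1 * t2 ->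
  c1 / 64 * t2 <= r2 <= 64 * (w * c2) * t2.
Proof.
move=> rl ru lo up /andP[W1 Ww] c0; have F0 : 0 <= F by exact: le_trans lo.
have WF : F <= W * F by rewrite ler_peMl.
have wF : W * F <= w * F by rewrite ler_wpM2r.
have w0 : 0 <= w by apply: le_trans Ww; apply: le_trans W1.
have wc := ler_wpM2l w0 up.
by apply/andP; split; [move: rl lo WF; lra|move: ru wF wc; lra].
Qed.

Unset Implicit Arguments.

Theorem proposition18 (R : realType) (d : nat -> nat) (gamma : nat -> R)
    (mu : forall n : nat, 'rV[R]_(d n))
    (gamma_gt0 : forall n, 0 < gamma n)
    (gamma_omega1 : (fun _ : nat => 1 : R) =o_\oo gamma)
    (mu_Omega1 :
      (fun n => norm2 (mu n) ^+ 2) =Omega_\oo (fun _ : nat => 1 : R)) :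
  let rho (n : nat) : R :=
    moment_ratio (gaussian (mu n))
      (u_ksd (gaussian_pdf (0 : 'rV[R]_(d n))) (rbf (gamma n))) in
  let D (n : nat) : R := (d n)%:R in
  let m (n : nat) : R := norm2 (mu n) in
  [/\ (gamma =o_\oo (fun n => Num.sqrt (D n)) ->
       exists e theta : nat -> R,
         [/\ e =o_\oo (fun n => D n / gamma n ^+ 2),
             theta =Theta_\oo
               (fun n => D n / (gamma n * m n ^+ 2)
                         + Num.sqrt (D n) / (Num.sqrt (gamma n) * m n) + 1) &
             forall n,
               rho n = expR (3 * D n / (4 * gamma n ^+ 2) + e n) * theta n]),
      ((fun n => Num.sqrt (D n)) =o_\oo gamma ->
       rho =Theta_\oo
         (fun n => Num.sqrt (D n) * (1 + (Num.sqrt (gamma n))^-1 * m n)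
                   / (m n * (1 + (gamma n)^-1 * Num.sqrt (D n) * m n)) + 1)) &
      (gamma =Theta_\oo (fun n => Num.sqrt (D n)) ->
       rho =Theta_\oo
         (fun n => Num.sqrt (D n) / m n ^+ 2
                   + Num.sqrt (Num.sqrt (D n)) / m n + 1))].
Proof.
move=> rho D m.
have D0 n : 0 <= D n by exact: ler0n.
have m0 n : 0 <= m n by exact: sqrtr_ge0.
have s2 n : Num.sqrt (D n) ^+ 2 = D n by rewrite sqr_sqrtr.
have gmg (a : R) : 0 < a -> \forall n \near \oo, a <= gamma n.
  move=> a0; have ai : 0 < a^-1 by rewrite invr_gt0.
  apply: filterS (littleo_near ai gamma_omega1) => n.
  by rewrite normr1 ger0_norm ?(ltW (gamma_gt0 n))// mulrC ler_pdivlMr// mul1r.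
have [k0 k00 mk0] := bigOmega_near mu_Omega1.
pose k := Num.min k0 1.
have k_gt0 : 0 < k by rewrite lt_min k00 ltr01.
have k_le1 : k <= 1 by rewrite ge_min lexx orbT.
have mk : \forall n \near \oo, k <= m n ^+ 2.
  apply: filterS mk0 => n; rewrite normr1 mulr1 ger0_norm ?sqr_ge0//.
  by apply: le_trans; rewrite ge_min lexx.
have base : \forall n \near \oo, [/\ 0 < m n, k <= m n ^+ 2, 0 <= rho n &
    expR (2 * log_factor (gamma n) (D n)) * rate (gamma n) (D n) (m n ^+ 2) / 64
    <= rho n ^+ 2 <=
    64 * (expR (2 * log_factor (gamma n) (D n)) * rate (gamma n) (D n) (m n ^+ 2))].
  have two : (0 : R) < 2 by [].
  apply: filterS2 (gmg 2 two) mk => n g2 kM.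
  have mp : 0 < m n.
    rewrite lt_def m0 andbT; apply: contraTneq kM => ->.
    by rewrite expr0n -ltNge.
  by have [r0 rb] := moment_ratio_bounds (mu := mu n) g2 mp; split.
split.
- (* The whole exponential factor is split off, and theta is what remains. *)
  move=> gs; pose L n := log_factor (gamma n) (D n).
  pose e n := L n - 3 * D n / (4 * gamma n ^+ 2).
  exists e, (fun n => rho n * expR (- L n)); split.
  + apply/eqoP => eps eps0.
    have e3 : 0 < 3 / eps by rewrite divr_gt0.
    apply: filterS (gmg _ e3) => n ge.
    rewrite (le_trans (log_factor_approx (gamma_gt0 n) (D0 n)))//.
    rewrite ger0_norm ?divr_ge0 ?sqr_ge0// ler_wpM2r ?divr_ge0 ?sqr_ge0//.
    by rewrite ler_pdivrMr// mulrC -ler_pdivrMr.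
  + (* Here t >= 1, whence 1 / 2 <= t / (1 + t). *)
    pose k' := Num.min k 2^-1.
    have k'0 : 0 < k' by rewrite lt_min k_gt0 invr_gt0 ltr0n.
    have k'1 : k' <= 1 by rewrite ge_min k_le1.
    have kk : 0 < k' ^+ 2 by rewrite exprn_gt0.
    apply: (@bigTheta_sqr _ _ _ (k' ^+ 2 / 16 / 64) (64 * (3 * 2 / k' ^+ 2))).
    * by rewrite !divr_gt0.
    * by rewrite mulr_gt0// divr_gt0.
    apply: filterS2 base (littleo_near ltr01 gs) => n [mp kM r0 rb] gD.
    have gp := gamma_gt0 n.
    have {}gD : gamma n ^+ 2 <= D n.
      rewrite -s2; apply: lerXn2r; rewrite ?nnegrE ?sqrtr_ge0 ?(ltW gp)//.
      by move: gD; rewrite mul1r !ger0_norm ?sqrtr_ge0 ?(ltW gp).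
    have Dp : 0 < D n by apply: lt_le_trans gD; rewrite exprn_gt0.
    have M0 : 0 < m n ^+ 2 by rewrite exprn_gt0.
    pose a := D n / (gamma n * m n ^+ 2).
    pose b := Num.sqrt (D n) / (Num.sqrt (gamma n) * m n).
    have a0 : 0 <= a by rewrite divr_ge0// mulr_ge0// ltW.
    have b0 : 0 <= b by rewrite divr_ge0 ?sqrtr_ge0// mulr_ge0 ?sqrtr_ge0.
    have ba : b ^+ 2 = a.
      by rewrite /b expr_div_n exprMn s2 sqr_sqrtr// ltW.
    have aM : a * m n ^+ 2 = D n / gamma n.
      by rewrite /a; field; rewrite !gt_eqF.
    have kM' : k' <= m n ^+ 2 by rewrite (le_trans _ kM)// ge_min lexx.
    have kt : k' <= damping (gamma n) (D n).
      rewrite (@le_trans _ _ 2^-1)//; first by rewrite ge_min lexx orbT.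
      rewrite /damping ler_pdivlMr; last by rewrite addr_gt0// exprn_gt0.
      by move: gD; lra.
    have hD : D n <= (D n / gamma n) ^+ 2.
      rewrite expr_div_n ler_pdivlMr ?exprn_gt0// [leRHS]expr2.
      by rewrite ler_wpM2l.
    have E : (a * m n ^+ 2) ^+ 2 <= (D n / gamma n) ^+ 2 + D n
        <= 2 * (a * m n ^+ 2) ^+ 2.
      by rewrite aM; apply/andP; split; move: hD; set h := _ ^+ 2; lra.
    have k'01 : 0 < k' <= 1 by rewrite k'0.
    have K2 : (1 : R) <= 2 by rewrite ler1n.
    have /andP[lo up] := rate_small_bandwidth k'01 K2 kM' gp (D0 n) kt a0 b0 ba E.
    have /andP[rl ru] := rb.
    split => //; first by rewrite mulr_ge0 ?expR_ge0.
      by rewrite addr_ge0// addr_ge0.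
    rewrite exprMn -[expR (- L n) ^+ 2]expRM_natl -/a -/b.
    have W : expR (2 * L n) * expR (2%:R * - L n) = 1.
      by rewrite mulrN expRxMexpNx_1.
    have w0 := expR_ge0 (2%:R * - L n).
    have := ler_wpM2r w0 rl; have := ler_wpM2r w0 ru.
    rewrite -/(L n); move: lo up W; rewrite -/a -/b.
    move: (rate _ _ _) (rho n ^+ 2) ((a + b + 1) ^+ 2) (expR (2 * L n))
      (expR (2%:R * - L n)) => F r2 t2 P Q lo up W.
    have -> : P * F / 64 * Q = P * Q * F / 64 by ring.
    have -> : 64 * (P * F) * Q = 64 * (P * Q * F) by ring.
    rewrite W mul1r => U1 U2; apply/andP; split; [move: lo U2|move: up U1]; lra.
  + move=> n; have -> : 3 * D n / (4 * gamma n ^+ 2) + e n = L n.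
      by rewrite /e addrC subrK.
    by rewrite mulrCA expRxMexpNx_1 mulr1.
- move=> sg.
  apply: (@bigTheta_sqr _ _ _ (9^-1 / 64) (64 * (expR (3 / 2) * 12))).
  + by rewrite divr_gt0// invr_gt0.
  + by rewrite !mulr_gt0 ?expR_gt0.
  apply: filterS2 base (littleo_near ltr01 sg) => n [mp kM r0 /andP[rl ru]] gD.
  have gp := gamma_gt0 n.
  have {}gD : Num.sqrt (D n) <= gamma n.
    by move: gD; rewrite mul1r !ger0_norm ?sqrtr_ge0 ?(ltW gp).
  have := rate_large_bandwidth gp (sqrtr_ge0 (D n)) gD mp erefl.
  set T := _ / _ + 1; rewrite s2 => /andP[lo up].
  have T0 : 0 <= T.
    have w0 : 0 <= (Num.sqrt (gamma n))^-1 by rewrite invr_ge0 sqrtr_ge0.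
    have g0 : 0 <= (gamma n)^-1 by rewrite invr_ge0 ltW.
    have sD := sqrtr_ge0 (D n).
    rewrite /T addr_ge0 ?ler01// divr_ge0//.
      by rewrite mulr_ge0// addr_ge0// mulr_ge0.
    by rewrite mulr_ge0// addr_ge0// mulr_ge0// mulr_ge0.
  split => //.
  have /andP[L0 L1] := log_factor_bounds gp (D0 n).
  have t1 : D n / gamma n ^+ 2 <= 1.
    rewrite ler_pdivrMr ?exprn_gt0// mul1r -s2 lerXn2r// nnegrE ?sqrtr_ge0//.
    exact: ltW.
  have W1 : 1 <= expR (2 * log_factor (gamma n) (D n)).
    by rewrite -expR0 ler_expR mulr_ge0.
  have W2 : expR (2 * log_factor (gamma n) (D n)) <= expR (3 / 2).
    by rewrite ler_expR; move: L1 t1; lra.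
  apply: absorb_bounded_factor rl ru _ up _ _; rewrite ?W1//.
    by move: lo; rewrite mulrC.
  by rewrite mulr_ge0 ?sqr_ge0// invr_ge0.
- move=> gT; have [[k1 k2] /= [k10 k20 gs]] := bigTheta_near gT.
  (* Here t >= 1 / k2^2, whence 1 / (k2^2 + 1) <= t / (1 + t). *)
  pose k' := Num.min k (k2 ^+ 2 + 1)^-1.
  have k22 : 0 < k2 ^+ 2 + 1 by rewrite addr_gt0// exprn_gt0.
  have k'0 : 0 < k' by rewrite lt_min k_gt0 invr_gt0.
  have k'1 : k' <= 1 by rewrite ge_min k_le1.
  have kk : 0 < k' ^+ 2 by rewrite exprn_gt0.
  pose K := 1 + (k1 ^+ 2)^-1.
  have k1i : 0 < (k1 ^+ 2)^-1 by rewrite invr_gt0 exprn_gt0.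
  have K1 : 1 <= K by rewrite lerDl ltW.
  have Kp : 0 < K by apply: lt_le_trans K1.
  apply: (@bigTheta_sqr _ _ _ (k' ^+ 2 / 16 / 64)
    (64 * (expR (3 / 2 * (k1 ^+ 2)^-1) * (3 * K / k' ^+ 2)))).
  + by rewrite !divr_gt0.
  + by rewrite !mulr_gt0 ?expR_gt0// invr_gt0.
  apply: filterS2 base gs => n [mp kM r0 /andP[rl ru]].
  have gp := gamma_gt0 n.
  rewrite !ger0_norm ?sqrtr_ge0 ?(ltW gp)// => /andP[g1 g2].
  have sp : 0 < Num.sqrt (D n) by rewrite -(pmulr_rgt0 _ k20) (lt_le_trans gp).
  have Dp : 0 < D n by rewrite -sqrtr_gt0.
  have gg : 0 < gamma n ^+ 2 by rewrite exprn_gt0.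
  have M0 : 0 < m n ^+ 2 by rewrite exprn_gt0.
  have gD1 : k1 ^+ 2 * D n <= gamma n ^+ 2.
    by rewrite -s2 -exprMn lerXn2r// nnegrE ltW// mulr_gt0.
  have gD2 : gamma n ^+ 2 <= k2 ^+ 2 * D n.
    by rewrite -s2 -exprMn lerXn2r// nnegrE ltW// mulr_gt0.
  pose a := Num.sqrt (D n) / m n ^+ 2.
  pose b := Num.sqrt (Num.sqrt (D n)) / m n.
  have a0 : 0 <= a by rewrite divr_ge0// ltW.
  have b0 : 0 <= b by rewrite divr_ge0 ?sqrtr_ge0.
  have ba : b ^+ 2 = a by rewrite /b expr_div_n sqr_sqrtr// ltW.
  have aM : (a * m n ^+ 2) ^+ 2 = D n by rewrite /a divfK ?gt_eqF.
  have kM' : k' <= m n ^+ 2 by rewrite (le_trans _ kM)// ge_min lexx.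
  have kt : k' <= damping (gamma n) (D n).
    rewrite (@le_trans _ _ (k2 ^+ 2 + 1)^-1)//; first by rewrite ge_min lexx orbT.
    rewrite /damping ler_pdivlMr ?addr_gt0// mulrC ler_pdivrMr//.
    by rewrite mulrDr mulr1 mulrC lerD2r.
  have t1 : D n / gamma n ^+ 2 <= (k1 ^+ 2)^-1.
    by rewrite ler_pdivrMr// mulrC ler_pdivlMr ?exprn_gt0// mulrC.
  have E : (a * m n ^+ 2) ^+ 2 <= (D n / gamma n) ^+ 2 + D n
      <= K * (a * m n ^+ 2) ^+ 2.
    rewrite aM lerDr sqr_ge0 /K mulrDl mul1r addrC lerD2l.
    have -> : (D n / gamma n) ^+ 2 = D n / gamma n ^+ 2 * D n.
      by rewrite expr_div_n; ring.
    by rewrite ler_wpM2r.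
  have k'01 : 0 < k' <= 1 by rewrite k'0.
  have /andP[lo up] := rate_small_bandwidth k'01 K1 kM' gp (D0 n) kt a0 b0 ba E.
  split => //; first by rewrite addr_ge0// addr_ge0.
  rewrite -/a -/b.
  have /andP[L0 L1] := log_factor_bounds gp (D0 n).
  have W1 : 1 <= expR (2 * log_factor (gamma n) (D n)).
    by rewrite -expR0 ler_expR mulr_ge0.
  have W2 : expR (2 * log_factor (gamma n) (D n)) <= expR (3 / 2 * (k1 ^+ 2)^-1).
    by rewrite ler_expR; move: L1 t1; lra.
  apply: absorb_bounded_factor rl ru lo up _ _; first by rewrite W1.
  by rewrite mulr_ge0 ?sqr_ge0// divr_ge0// ltW.
Qed.
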